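(* Let $\mathbb{F}$ be a perfect field of positive characteristic. Let $R=\bigoplus_{n\geq 0}R_n$ and $S=\bigoplus_{n\geq 0}S_n$ be $\mathbb{N}$-graded reduced rings, finitely generated as algebras over $R_0=\mathbb{F}=S_0$. If $R$ and $S$ have finite Frobenius representation type (FFRT), then the rings $R\otimes_{\mathbb{F}}S$ and $R\,\#\,S$ also have FFRT.
   Context: All rings are commutative and Noetherian; $\mathbb{N}$ includes $0$. Segre product: for $\mathbb{N}$-graded rings $R$ and $S$, finitely generated over a field $R_0=\mathbb{F}=S_0$, the Segre product is the $\mathbb{N}$-graded ring $R\,\#\,S:=\bigoplus_{n\geq 0}R_n\otimes_{\mathbb{F}}S_n$, a subring of $R\otimes_{\mathbb{F}}S$. FFRT: a reduced ring $A$ of prime characteristic $p>0$, satisfying the Krull-Schmidt theorem (finitely generated modules decompose uniquely, up to isomorphism and order, as finite direct sums of indecomposable modules), has finite Frobenius representation type (FFRT) if there exists a finite set $\mathcal{S}$ of $A$-modules such that for each $q=p^e$, each indecomposable direct summand of the $A$-module $A^{1/q}$ is isomorphic to an element of $\mathcal{S}$. Here $A^{1/q}$ is the ring of $q$-th roots of elements of $A$, viewed as an $A$-module via $A\subseteq A^{1/q}$. For $\mathbb{N}$-graded rings $A$, finitely generated over a field $A_0$, the Krull-Schmidt theorem holds for finitely generated graded modules. For such rings, the definition of FFRT is understood in the graded sense: $A^{1/q}$ is a $\mathbb{Q}$-graded $A$-module (with $\deg a^{1/q}=\frac{1}{q}\deg a$), one considers decompositions into indecomposable finitely generated $\mathbb{Q}$-graded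 modules, and isomorphism is up to a shift of degree. *)

(* Defs.v *)
From HB Require Import structures.
From mathcomp Require Import all_boot all_order all_algebra.
From mathcomp Require Import boolp classical_sets.

Set Implicit Arguments.
Unset Strict Implicit.
Unset Printing Implicit Defensive.

Import GRing.Theory.
Local Open Scope classical_set_scope.
Local Open Scope ring_scope.

(** Gradings are families of additive subgroups of a fixed carrier. *)

Definition direct_sum (I : eqType) (V : zmodType) (G : I -> set V) : Prop :=
  [/\ forall i, zmod_closed (mem (G i)),
      forall x, exists s (f : I -> V),
        [/\ uniq s, forall i, G i (f i) & x = \sum_(i <- s) f i]
    & forall s (f : I -> V), uniq s -> (forall i, G i (f i)) ->
        \sum_(i <- s) f i = 0 -> {in s, forall i, f i = 0}].

Definition fg_algebra (F : fieldType) (A : comAlgType F) : Prop :=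
  exists s : seq A, forall P : {pred A},
    subalg_closed P -> {subset s <= P} -> forall a, a \in P.

(* The third clause is A_0 = F. *)
Definition ngraded (F : fieldType) (A : comAlgType F) (gA : nat -> set A) :=
  [/\ direct_sum gA,
      forall m n a b, gA m a -> gA n b -> gA (m + n)%N (a * b),
      forall a, gA 0%N a <-> exists c : F, a = c%:A
    & fg_algebra A].

Definition reduced (A : nzRingType) : Prop :=
  forall (a : A) n, a ^+ n = 0 -> a = 0.

Section GradedModules.
Variables (F : fieldType) (A : comAlgType F) (gA : nat -> set A).

Definition qgraded (M : lmodType A) (gM : rat -> set M) : Prop :=
  direct_sum gM /\
  forall n d a x, gA n a -> gM d x -> gM (n%:R + d) (a *: x).

Definition fg_module (M : lmodType A) : Prop :=
  exists k (x : 'I_k -> M), forall y,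
    exists c : 'I_k -> A, y = \sum_i c i *: x i.

Definition gr_iso (M N : lmodType A) (gM : rat -> set M) (gN : rat -> set N) :=
  exists f : {linear M -> N},
    bijective f /\ forall d x, gM d x <-> gN d (f x).

Definition gr_shift (M : lmodType A) (c : rat) (gM : rat -> set M) :
  rat -> set M := fun d => gM (c + d).

Definition gr_dsum (M N : lmodType A) (gM : rat -> set M) (gN : rat -> set N) :
  rat -> set (M * N)%type := fun d => [set x | gM d x.1 /\ gN d x.2].

Definition gr_summand (M L : lmodType A) (gM : rat -> set M)
    (gL : rat -> set L) : Prop :=
  exists (N : lmodType A) (gN : rat -> set N),
    qgraded gN /\ gr_iso (gr_dsum gM gN) gL.

Definition gr_indecomposable (M : lmodType A) (gM : rat -> set M) : Prop :=
  (exists x : M, x != 0) /\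
  forall (N1 N2 : lmodType A) (g1 : rat -> set N1) (g2 : rat -> set N2),
    qgraded g1 -> qgraded g2 -> gr_iso (gr_dsum g1 g2) gM ->
    (forall x : N1, x = 0) \/ (forall x : N2, x = 0).

End GradedModules.

(** The A-module A^{1/q}, q = p ^ e, for A of characteristic p.  The element
    x of [frob_root chF A e] stands for the root x^{1/q}; addition of roots is
    addition in A, the inclusion of A in A^{1/q} sends a to (a^q)^{1/q}, and so
    a . x^{1/q} = (a^q x)^{1/q}.  This describes the ring of q-th roots when A
    is reduced, which [FFRT] requires. *)

Section FrobeniusRoot.
Variables (F : fieldType) (p : nat) (chF : p \in [pchar F]).
Variables (A : comAlgType F) (e : nat).

Definition frob_root of p \in [pchar F] & nat : Type := A.
Local Notation root := (frob_root chF e).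

HB.instance Definition _ := GRing.Zmodule.on root.

Definition frob_scale (a : A) (x : root) : root := a ^+ (p ^ e) * (x : A).

Lemma exprD_pchar (a b : A) :
  (a + b) ^+ (p ^ e) = a ^+ (p ^ e) + b ^+ (p ^ e).
Proof.
have chA : p \in [pchar A] by apply: (rmorph_pchar (in_alg A)).
apply: exprDn_pchar; rewrite pnatX; apply/orP; left.
by rewrite pnatE ?(pcharf_prime chF).
Qed.

Fact frob_scaleA (a b : A) (x : root) :
  frob_scale a (frob_scale b x) = frob_scale (a * b) x.
Proof. by rewrite /frob_scale exprMn mulrA. Qed.

Fact frob_scale1 : left_id 1 frob_scale.
Proof. by move=> x; rewrite /frob_scale expr1n mul1r. Qed.

Fact frob_scaleDr : right_distributive frob_scale +%R.
Proof. by move=> a x y; rewrite /frob_scale -mulrDr. Qed.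

Fact frob_scaleDl (x : root) : {morph frob_scale^~ x : a b / a + b}.
Proof. by move=> a b; rewrite /frob_scale exprD_pchar mulrDl. Qed.

HB.instance Definition _ := GRing.Zmodule_isLmodule.Build A root
  frob_scaleA frob_scale1 frob_scaleDr frob_scaleDl.

(* deg x^{1/q} = (deg x) / q; the component is 0 in degrees outside (1/q)N. *)
Definition frob_root_grading (gA : nat -> set A) : rat -> set root :=
  fun d => [set x | x = 0 \/
                    exists2 n, d = n%:R / (p ^ e)%:R & gA n (x : A)].

End FrobeniusRoot.

Arguments frob_root {F p} A chF e.
Arguments frob_root_grading {F p} chF {A} e gA.

Definition FFRT (F : fieldType) (p : nat) (chF : p \in [pchar F])
    (A : comAlgType F) (gA : nat -> set A) : Prop :=
  [/\ ngraded gA, reduced A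
    & exists (k : nat) (L : 'I_k -> lmodType A) (gL : forall i, rat -> set (L i)),
        (forall i, qgraded gA (gL i)) /\
        forall (e : nat) (M : lmodType A) (gM : rat -> set M),
          qgraded gA gM -> fg_module M -> gr_indecomposable gA gM ->
          gr_summand gA gM (frob_root_grading chF e gA) ->
          exists i c, gr_iso (gr_shift c gM) (gL i)].

(** T, with iR and iS, is the tensor product of R and S over F: the map
    (r, s) |-> iR r * iS s is the universal bilinear map out of R x S.  As iR
    and iS are algebra morphisms, the product of T is the usual one. *)
Definition is_tensor (F : fieldType) (R S T : comAlgType F)
    (iR : {lrmorphism R -> T}) (iS : {lrmorphism S -> T}) : Prop :=
  forall (V : lmodType F) (f : R -> S -> V),
    (forall r, linear (f r)) -> (forall s, linear (f^~ s)) ->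
    exists2 g : {linear T -> V}, forall r s, g (iR r * iS s) = f r s &
      forall h : {linear T -> V}, (forall r s, h (iR r * iS s) = f r s) ->
        h =1 g.

Section Products.
Variables (F : fieldType) (R S T : comAlgType F).
Variables (iR : {lrmorphism R -> T}) (iS : {lrmorphism S -> T}).
Variables (gR : nat -> set R) (gS : nat -> set S).

(* The finite sums of the tensors of r and s with P r s; the sets P used below
   are stable under scaling of r, so that these sums form a subspace. *)
Definition tensor_sums (P : R -> S -> Prop) : set T :=
  [set t | exists k (r : 'I_k -> R) (s : 'I_k -> S),
     (forall i, P (r i) (s i)) /\ t = \sum_i iR (r i) * iS (s i)].

Definition tensor_grading (n : nat) : set T :=
  tensor_sums (fun r s => exists i j, [/\ (i + j)%N = n, gR i r & gS j s]).

Definition in_segre : pred T :=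
  fun t => `[< tensor_sums (fun r s => exists n, gR n r /\ gS n s) t >].

Lemma ngraded_scale (A : comAlgType F) (gA : nat -> set A) :
  ngraded gA -> forall n c a, gA n a -> gA n (c *: a).
Proof.
move=> [_ gM g0 _] n c a an; rewrite -mulr_algl -[n]add0n.
by apply: gM => //; apply/g0; exists c.
Qed.

Lemma ngraded1 (A : comAlgType F) (gA : nat -> set A) :
  ngraded gA -> gA 0%N 1.
Proof. by move=> [_ _ g0 _]; apply/g0; exists 1; rewrite scale1r. Qed.

Hypotheses (hR : ngraded gR) (hS : ngraded gS).

Lemma segre_closed : subalg_closed in_segre.
Proof.
split.
- apply/asboolP; exists 1, (fun=> 1), (fun=> 1); split.
    by move=> _; exists 0%N; split; apply: ngraded1.
  by rewrite big_ord1 !rmorph1 mulr1.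
- move=> c _ _ /asboolP[k [r [s [Prs ->]]]] /asboolP[l [r' [s' [Prs' ->]]]].
  apply/asboolP; exists (k + l)%N.
  exists (fun i => match split i with inl j => c *: r j | inr j => r' j end).
  exists (fun i => match split i with inl j => s j | inr j => s' j end); split.
    move=> i; case: (split i) => j //.
    by have [n [rn sn]] := Prs j; exists n; split=> //; apply: ngraded_scale.
  rewrite big_split_ord /= scaler_sumr; congr (_ + _); apply: eq_bigr => i _.
    by rewrite (unsplitK (inl i)) linearZ /= scalerAl.
  by rewrite (unsplitK (inr i)).
- move=> _ _ /asboolP[k [r [s [Prs ->]]]] /asboolP[l [r' [s' [Prs' ->]]]].
  apply/asboolP; exists #|{: 'I_k * 'I_l}|.
  exists (fun i => r (enum_val i).1 * r' (enum_val i).2).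
  exists (fun i => s (enum_val i).1 * s' (enum_val i).2); split.
    move=> i; have [m [rm sm]] := Prs (enum_val i).1.
    have [n [rn sn]] := Prs' (enum_val i).2; exists (m + n)%N.
    by case: hR hS => _ hRM _ _ [_ hSM _ _]; split; [apply: hRM | apply: hSM].
  rewrite big_distrlr /= pair_big /=.
  rewrite (reindex (@enum_val _ (mem {: 'I_k * 'I_l}))) /=; last first.
    exact/onW_bij/enum_val_bij.
  by apply: eq_bigr => i _; rewrite !rmorphM /= mulrACA.
Qed.

(** The Segre product, as a subalgebra of the tensor product T.  It depends on
    the proofs that R and S are graded because these are what makes it one. *)
Definition segre of ngraded gR & ngraded gS : Type := {t : T | in_segre t}.
Local Notation segreRS := (segre hR hS).

HB.instance Definition _ := SubChoice.on segreRS.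
HB.instance Definition _ :=
  GRing.SubChoice_isSubAlgebra.Build F T in_segre segreRS segre_closed.
HB.instance Definition _ :=
  GRing.SubNzRing_isSubComNzRing.Build T in_segre segreRS.

Definition segre_grading (n : nat) : set segreRS :=
  [set t | tensor_sums (fun r s => gR n r /\ gS n s) (val t)].

End Products.

Arguments tensor_grading {F R S T} iR iS gR gS n.
Arguments segre {F R S T} iR iS {gR gS} hR hS.
Arguments segre_grading {F R S T} iR iS {gR gS} hR hS n.

(* Main.v *)
(* Write q = p^e.  By Fitting's lemma a finitely generated indecomposable graded
   module has a local ring of endomorphisms of degree 0: if its identity is a
   sum of endomorphisms of degree 0, then one of them is bijective.  Hence A has
   FFRT as soon as there is a finite set of exponents e_0 such that, for every e,
   the identity of A^{1/q} is a sum of maps of degree 0 factoring through shifts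
   of the modules A^{1/p^{e_0}}.

   Let the finitely many modules L_i, N_j witness FFRT for R and S.  For each
   pair (i, j) choose, if possible, one exponent e_0 for which L_i is a summand
   of R^{1/p^{e_0}} and N_j one of S^{1/p^{e_0}}, up to shifts.  As F is perfect,
   (R (x) S)^{1/q} = R^{1/q} (x) S^{1/q}, whose identity thus factors through the
   modules (R (x) S)^{1/p^{e_0}}.  The Segre product is the diagonal, to which
   the maps restrict if the shifts a of L_i and b of N_j change by the same
   amount between e and e_0; so e_0 is also made to depend on c = b - a.  Only
   finitely many c matter: since R^{1/q} and S^{1/q} are generated in degrees
   bounded independently of q, so is c for given i and j, and terms that do not
   vanish on the diagonal have c in one coset of the integers because
   indecomposable modules are supported in one coset. *)

From HB Require Import structures.
Require Import Defs.
From mathcomp Require Import all_boot all_order all_algebra.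
From mathcomp Require Import boolp classical_sets.
From mathcomp Require Import lra.
Set Implicit Arguments.
Unset Strict Implicit.
Unset Printing Implicit Defensive.
Import Order.TTheory GRing.Theory Num.Theory.
Local Open Scope ring_scope.

(** * Direct sums *)

(** The natural candidates for the finite sets are the tensor products of [L_i] and [N_j] and their
    diagonals, but [T] is known only through its universal property, and each such module would need
    its own construction. Factoring through Frobenius roots leaves only maps between roots of [T] to
    be built, and these come from the universal property of [T] once semilinear maps over F are made
    linear by twisting the action of F. This is why one exponent e_0 must serve both factors: two
    maps can be tensored only if they are semilinear for the same endomorphism of F, here the one
    that sends c^{p^e} to c^{p^{e_0}}.

    The shifts at which a given module occurs in a root are confined from two sides: generators of
    roots have degree at most a constant D, and no nonzero element of a root has negative degree.
    Comparing two occurrences of the same module, in either order, bounds the difference of their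
    shifts by D. *)

Lemma dependent_choice (I : Type) (T : I -> Type) (P : forall i, T i -> Prop) :
  (forall i, exists x, P i x) -> exists f : forall i, T i, forall i, P i (f i).
Proof. by move=> h; exists (fun i => sval (cid (h i))) => i; case: cid. Qed.

Section DirectSum.
Variables (I : eqType) (V : zmodType) (G : I -> set V).
Hypothesis hG : direct_sum G.

Lemma ds0 i : G i 0.
Proof. by case: hG => /(_ i)[+ _] _ _; rewrite in_setE. Qed.

Lemma dsB i x y : G i x -> G i y -> G i (x - y).
Proof.
case: hG => /(_ i)[_ h] _ _ hx hy.
by move: (h x y); rewrite !in_setE; apply.
Qed.

Lemma dsD i x y : G i x -> G i y -> G i (x + y).
Proof.
move=> hx hy; rewrite -[y]opprK; apply: dsB => //.
by rewrite -[- y]sub0r; apply: dsB => //; apply: ds0.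
Qed.

Lemma ds_sum i (J : Type) (r : seq J) (P : pred J) (f : J -> V) :
  (forall j, P j -> G i (f j)) -> G i (\sum_(j <- r | P j) f j).
Proof. by move=> h; elim/big_ind: _ => //; [apply: ds0 | apply: dsD]. Qed.

Lemma ds_indep s (f : I -> V) : uniq s -> (forall i, G i (f i)) ->
  \sum_(i <- s) f i = 0 -> {in s, forall i, f i = 0}.
Proof. by case: hG => _ _; apply. Qed.

Lemma big_uniq_sub (s t : seq I) (f : I -> V) :
  uniq s -> uniq t -> {subset s <= t} ->
  \sum_(i <- s) f i = \sum_(i <- t) (if i \in s then f i else 0).
Proof.
move=> us ut st; rewrite -big_mkcond /= -[RHS]big_filter; apply: perm_big.
apply: uniq_perm => //; first exact: filter_uniq.
by move=> i; rewrite mem_filter; case: (boolP (i \in s)) => //= /st ->.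
Qed.

Lemma ds_uniq s t (f g : I -> V) : uniq s -> uniq t ->
  (forall i, G i (f i)) -> (forall i, G i (g i)) ->
  \sum_(i <- s) f i = \sum_(i <- t) g i ->
  forall i, (if i \in s then f i else 0) = (if i \in t then g i else 0).
Proof.
move=> us ut hf hg e.
set w := undup (s ++ t).
have uw : uniq w by exact: undup_uniq.
have sw : {subset s <= w} by move=> i hi; rewrite mem_undup mem_cat hi.
have tw : {subset t <= w} by move=> i hi; rewrite mem_undup mem_cat hi orbT.
rewrite (big_uniq_sub f us uw sw) (big_uniq_sub g ut uw tw) in e.
move/eqP: e; rewrite -subr_eq0 -sumrB => /eqP e i.
have hd j : G j ((if j \in s then f j else 0) - (if j \in t then g j else 0)).
  by apply: dsB; case: ifP => // _; apply: ds0.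
have [iw|] := boolP (i \in w).
  by apply/eqP; rewrite -subr_eq0; apply/eqP/(ds_indep uw hd e iw).
by rewrite mem_undup mem_cat negb_or => /andP[/negPf-> /negPf->].
Qed.

Lemma dproj_spec x : exists pr : I -> V, exists2 s : seq I, uniq s &
  [/\ forall i, G i (pr i), forall i, i \notin s -> pr i = 0
    & x = \sum_(i <- s) pr i].
Proof.
case: hG => _ /(_ x)[s [f [us hf ->]]] _.
exists (fun i => if i \in s then f i else 0), s => //; split.
- by move=> i; case: ifP => // _; apply: ds0.
- by move=> i /negPf->.
- by apply: eq_big_seq => i ->.
Qed.

End DirectSum.

(** Total in [G], with value 0 when [G] is not a direct sum, so that terms carry no proof of
    [direct_sum]. *)
Definition dproj (I : eqType) (V : zmodType) (G : I -> set V) (i : I) (x : V) :=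
  if pselect (direct_sum G) is left hG then
    sval (cid (dproj_spec hG x)) i
  else 0.

Section Projections.
Variables (I : eqType) (V : zmodType) (G : I -> set V).
Hypothesis hG : direct_sum G.
Local Notation pr := (dproj G).

Lemma dprojP x : exists2 s : seq I, uniq s &
  [/\ forall i, G i (pr i x), forall i, i \notin s -> pr i x = 0
    & x = \sum_(i <- s) pr i x].
Proof. by rewrite /dproj; case: pselect => // h; case: cid. Qed.

Lemma dproj_in i x : G i (pr i x).
Proof. by have [s _ []] := dprojP x. Qed.

Lemma dproj_uniq (s : seq I) (f : I -> V) x : uniq s -> (forall i, G i (f i)) ->
  x = \sum_(i <- s) f i -> forall i, pr i x = if i \in s then f i else 0.
Proof.
move=> us hf ex i; have [t ut [ht ot et]] := dprojP x.
rewrite -(ds_uniq hG ut us ht hf (etrans (esym et) ex) i).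
by case: ifPn => // /ot.
Qed.

Lemma dproj_hom i j x : G j x -> pr i x = if i == j then x else 0.
Proof.
move=> hx.
have := @dproj_uniq [:: j] (fun k => if k == j then x else 0) x isT.
rewrite big_seq1 eqxx => /(_ _ erefl i) ->; last first.
  by move=> k; case: eqP => [->//|_]; apply: ds0.
by rewrite inE; case: eqP.
Qed.

Lemma dprojD i x y : pr i (x + y) = pr i x + pr i y.
Proof.
have [s us [hs os es]] := dprojP x; have [t ut [ht ot et]] := dprojP y.
pose w := undup (s ++ t).
have uw : uniq w by exact: undup_uniq.
have sw : {subset s <= w} by move=> k hk; rewrite mem_undup mem_cat hk.
have tw : {subset t <= w} by move=> k hk; rewrite mem_undup mem_cat hk orbT.
rewrite (@dproj_uniq w (fun k => pr k x + pr k y)) //.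
- case: ifPn => //; rewrite mem_undup mem_cat negb_or => /andP[/os-> /ot->].
  by rewrite addr0.
- by move=> k; apply: dsD.
rewrite big_split /= {1}es {1}et (big_uniq_sub _ us uw sw) (big_uniq_sub _ ut uw tw).
congr (_ + _); apply: eq_bigr => k _.
  by case: ifPn => // /os.
by case: ifPn => // /ot.
Qed.

Lemma dproj0 i : pr i 0 = 0.
Proof. by apply: (addrI (pr i 0)); rewrite -dprojD !addr0. Qed.

Lemma dproj_sum i (J : Type) (r : seq J) (P : pred J) (f : J -> V) :
  pr i (\sum_(j <- r | P j) f j) = \sum_(j <- r | P j) pr i (f j).
Proof. by apply: (big_morph _ (dprojD i) (dproj0 i)). Qed.

Lemma dproj_eq0 x : (forall i, pr i x = 0) -> x = 0.
Proof.
by move=> h; have [s _ [_ _ ->]] := dprojP x; rewrite big1.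
Qed.

End Projections.

(** Injectivity of [u] keeps the images of distinct components in distinct degrees, so that no terms
    merge. In the applications [u] is the identity or a translation of degrees. *)
Lemma dproj_morph (I J : eqType) (V W : zmodType) (G : I -> set V)
    (H : J -> set W) (u : I -> J) (f : {additive V -> W}) :
  direct_sum G -> direct_sum H -> injective u ->
  (forall i x, G i x -> H (u i) (f x)) ->
  forall i x, dproj H (u i) (f x) = f (dproj G i x).
Proof.
move=> hG hH uI hf i x; have [s us [hs os es]] := dprojP hG x.
rewrite {1}es raddf_sum dproj_sum //.
under eq_bigr => k _ do
  rewrite (dproj_hom hH _ (hf _ _ (hs k))) (inj_eq uI) eq_sym.
have [si|si] := boolP (i \in s); last first.
  rewrite os // raddf0; apply: big1_seq => k /andP[_ ks].
  by case: eqP => // ki; rewrite -ki ks in si.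
rewrite -big_mkcond /= (big_rem i) //= eqxx big1_seq ?addr0 // => k.
by move=> /andP[/eqP->]; rewrite mem_rem_uniqF.
Qed.

(** Merges terms of equal degree, because [direct_sum] asks for lists of distinct degrees. Closure
    of the components is the hypothesis since the lemma serves to prove that [G] is a direct sum. *)
Lemma collect_homog (I J : eqType) (V : zmodType) (G : I -> set V)
    (r : seq J) (d : J -> I) (y : J -> V) :
  (forall i, zmod_closed (mem (G i))) ->
  (forall j, j \in r -> G (d j) (y j)) ->
  exists s (f : I -> V), [/\ uniq s, forall i, G i (f i)
    & \sum_(j <- r) y j = \sum_(i <- s) f i].
Proof.
move=> hG hy; exists (undup (map d r)), (fun i => \sum_(j <- r | d j == i) y j).
split; first exact: undup_uniq.
  move=> i; have [h0 hB] := hG i; rewrite !in_setE in h0; rewrite big_seq_cond.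
  apply: (big_ind (G i)) => //; last by move=> j /andP[/hy + /eqP <-].
  move=> a b ha hb; have : a - (0 - b) \in mem (G i).
    by apply: (hB); [|apply: hB]; rewrite in_setE.
  by rewrite in_setE sub0r opprK.
rewrite (exchange_big_dep xpredT) //=; rewrite [LHS]big_seq [RHS]big_seq.
apply: eq_bigr => j jr; rewrite (big_rem (d j)) /=; last first.
  by rewrite mem_undup map_f.
rewrite eqxx big1_seq ?addr0 // => i /andP[/eqP<-].
by rewrite mem_rem_uniqF ?undup_uniq.
Qed.

(** * Graded algebras *)

Section Monomials.
Variables (F : fieldType) (A : comAlgType F) (K : nat).
Implicit Types (g : 'I_K -> A) (m : 'I_K -> nat) (u v : {ffun 'I_K -> nat}).

Definition mon g u : A := \prod_k g k ^+ u k.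
Definition mdeg m u : nat := (\sum_k u k * m k)%N.
Definition mcomb g (a : A) := exists l : seq (F * {ffun 'I_K -> nat}),
  a = \sum_(z <- l) z.1 *: mon g z.2.

Lemma mon0 g : mon g [ffun=> 0%N] = 1.
Proof. by rewrite /mon big1 // => k _; rewrite ffunE. Qed.

Lemma monD g u v : mon g [ffun k => (u k + v k)%N] = mon g u * mon g v.
Proof.
by rewrite /mon -big_split; apply: eq_bigr => k _; rewrite ffunE exprD.
Qed.

Lemma mon1 g k : mon g [ffun j => nat_of_bool (j == k)] = g k.
Proof.
rewrite /mon (bigD1 k) //= ffunE eqxx expr1 big1 ?mulr1 // => j /negPf jk.
by rewrite ffunE jk.
Qed.

Lemma mcomb_mon g u : mcomb g (mon g u).
Proof. by exists [:: (1, u)]; rewrite big_seq1 scale1r. Qed.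

Lemma mcomb_closed g : subalg_closed (fun a => `[< mcomb g a >]).
Proof.
split.
- by apply/asboolP; rewrite -(mon0 g); apply: mcomb_mon.
- move=> c _ _ /asboolP[l ->] /asboolP[l' ->]; apply/asboolP.
  exists ([seq (c * z.1, z.2) | z <- l] ++ l').
  rewrite big_cat big_map scaler_sumr; congr (_ + _).
  by apply: eq_bigr => z _; rewrite scalerA.
- move=> _ _ /asboolP[l ->] /asboolP[l' ->]; apply/asboolP.
  pose pr (z z' : F * {ffun 'I_K -> nat}) :=
    (z.1 * z'.1, [ffun k => (z.2 k + z'.2 k)%N]).
  exists [seq pr z z' | z <- l, z' <- l'].
  rewrite big_allpairs_dep big_distrlr; apply: eq_bigr => z _; apply: eq_bigr => z' _.
  by rewrite monD /= -scalerAl -scalerAr scalerA.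
Qed.

Lemma mon_subalg g (P : {pred A}) : subalg_closed P ->
  (forall k, g k \in P) -> forall u, mon g u \in P.
Proof.
move=> [P1 _ PM] hP u; apply: (big_ind (fun a => a \in P)) => // k _.
by elim: (u k) => [|n IHn]; rewrite ?expr0 // exprS; apply: PM.
Qed.

Lemma subalg_sum (P : {pred A}) : subalg_closed P ->
  forall (I : Type) (r : seq I) (Q : pred I) (c : I -> F) (f : I -> A),
  (forall i, Q i -> f i \in P) -> \sum_(i <- r | Q i) c i *: f i \in P.
Proof.
move=> [P1 PL PM] I r Q c f hP.
have P0 : 0 \in P by rewrite -(addNr 1) -scaleN1r; apply: PL.
have PD a b : a \in P -> b \in P -> a + b \in P.
  by move=> ha hb; rewrite -[a]scale1r; apply: PL.
apply: (big_ind (fun a => a \in P)) => // i /hP hi.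
by rewrite -[_ *: _]addr0; apply: PL.
Qed.

Lemma mdegD m u v : mdeg m [ffun k => (u k + v k)%N] = (mdeg m u + mdeg m v)%N.
Proof.
by rewrite /mdeg -big_split; apply: eq_bigr => k _; rewrite ffunE mulnDl.
Qed.

(** Euclidean division of the exponents. The first factor acts on A^{1/q} as a scalar, and for q > 0
    the second ranges over a finite set; both the finite generation of A^{1/q} and the uniform
    degree bound rest on this. *)
Lemma mon_divn g u q : mon g u =
  mon g [ffun k => u k %/ q]%N ^+ q * mon g [ffun k => u k %% q]%N.
Proof.
rewrite /mon -prodrXl -big_split; apply: eq_bigr => k _ /=.
by rewrite !ffunE -exprM -exprD -divn_eq.
Qed.

Lemma mdeg_le m u k : (0 < m k)%N -> (u k <= mdeg m u)%N.
Proof.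
move=> mk; rewrite /mdeg (bigD1 k) //=; apply: leq_trans (leq_addr _ _).
exact: leq_pmulr.
Qed.

Lemma mdeg_bound m u q : (forall k, (u k <= q)%N) ->
  (mdeg m u <= (\sum_k m k) * q)%N.
Proof.
move=> h; rewrite big_distrl; apply: leq_sum => k _ /=.
by rewrite mulnC leq_mul2l h orbT.
Qed.

End Monomials.

Section HomogeneousGenerators.
Variables (F : fieldType) (A : comAlgType F) (gA : nat -> set A).
Hypothesis hA : ngraded gA.

Lemma ng_ds : direct_sum gA. Proof. by case: hA. Qed.

Lemma ng1 : gA 0%N 1. Proof. exact: ngraded1 hA. Qed.

Lemma ngM m n a b : gA m a -> gA n b -> gA (m + n)%N (a * b).
Proof. by case: hA => _ + _ _; apply. Qed.

Lemma ngX m n a : gA m a -> gA (n * m)%N (a ^+ n).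
Proof.
move=> ha; elim: n => [|n IHn]; first by rewrite expr0; apply: ng1.
by rewrite exprS mulSn; apply: ngM.
Qed.

Lemma ng0P a : gA 0%N a -> exists c : F, a = c%:A.
Proof. by case: hA => _ _ h _ /h. Qed.

Lemma ng_mon K (g : 'I_K -> A) (m : 'I_K -> nat) u :
  (forall k, gA (m k) (g k)) -> gA (mdeg m u) (mon g u).
Proof.
move=> hg; rewrite /mdeg /mon; apply: (big_rec2 (fun n a => gA n a)).
  exact: ng1.
by move=> k n a _ ha; apply: ngM => //; apply: ngX.
Qed.

(** Positivity of the degrees [m k] bounds the exponents of the monomials of a given degree. *)
Definition hgens K (g : 'I_K -> A) (m : 'I_K -> nat) :=
  [/\ forall k, (0 < m k)%N, forall k, gA (m k) (g k),
      forall a, mcomb g a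
    & forall n a, gA n a -> exists l : seq (F * {ffun 'I_K -> nat}),
        (forall z, z \in l -> mdeg m z.2 = n) /\
        a = \sum_(z <- l) z.1 *: mon g z.2].

(** The components of positive degree of any generators suffice, since those of degree 0 are scalars
    by A_0 = F. *)
Lemma hgens_ex : exists K (g : 'I_K -> A) m, hgens g m.
Proof.
have hds := ng_ds.
case: hA => _ _ _ [s hs].
have [t ht] : exists t : A -> seq nat, forall a,
    a = \sum_(n <- t a) dproj gA n a.
  apply: (@dependent_choice _ _ (fun a t => a = \sum_(n <- t) dproj gA n a)) => a.
  by have [r _ [_ _ e]] := dprojP hds a; exists r.
pose L := flatten [seq [seq (n, dproj gA n a) | n <- t a & (0 < n)%N] | a <- s].
have LP z : z \in L -> (0 < z.1)%N /\ gA z.1 z.2.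
  move=> /flattenP[_ /mapP[a _ ->] /mapP[n]]; rewrite mem_filter => /andP[n0 _] ->.
  by split=> //; apply: dproj_in.
pose g (k : 'I_(size L)) := (nth (0%N, 0) L k).2.
pose m (k : 'I_(size L)) := (nth (0%N, 0) L k).1.
have hm k : (0 < m k)%N /\ gA (m k) (g k) by apply: LP; rewrite mem_nth.
have hmc a : mcomb g a.
  apply/asboolP; have := hs _ (mcomb_closed g); apply => {}a sa.
  rewrite (ht a); under eq_bigr => n _ do rewrite -[dproj _ _ _]scale1r.
  rewrite big_seq.
  apply: (subalg_sum (mcomb_closed g)) => n tn; apply/asboolP.
  have [n0|n0] := posnP n.
    have := dproj_in hds n a; rewrite {1}n0 => /ng0P[c ->].
    by exists [:: (c, [ffun=> 0%N])]; rewrite big_seq1 mon0.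
  have zL : (n, dproj gA n a) \in L.
    apply/flattenP; exists [seq (n, dproj gA n a) | n <- t a & (0 < n)%N].
      exact: map_f.
    by apply: map_f; rewrite mem_filter n0.
  have kL := zL; rewrite -index_mem in kL.
  have -> : dproj gA n a = g (Ordinal kL) by rewrite /g /= nth_index.
  by rewrite -mon1; apply: mcomb_mon.
exists (size L), g, m; split => //.
- by move=> k; case: (hm k).
- by move=> k; case: (hm k).
move=> n a ha; have [l al] := hmc a.
exists [seq z <- l | mdeg m z.2 == n]; split.
  by move=> z; rewrite mem_filter => /andP[/eqP].
have := dproj_hom hds n ha; rewrite eqxx => <-.
rewrite al dproj_sum // big_filter [RHS]big_mkcond; apply: eq_bigr => z _.
rewrite (dproj_hom hds n (_ : gA (mdeg m z.2) _)) 1?eq_sym //.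
by apply: (ngraded_scale hA); apply: ng_mon => k; case: (hm k).
Qed.

(** Exponents in a monomial of degree [n] are at most [n], as all generators have positive degree;
    [b] lists all monomials with such exponents. *)
Lemma graded_piece_fin n : exists (J : finType) (b : J -> A),
  forall a, gA n a -> exists c : J -> F, a = \sum_j c j *: b j.
Proof.
have [K [g [m [m0 _ _ hg]]]] := hgens_ex.
exists {ffun 'I_K -> 'I_n.+1}, 
  (fun u : {ffun 'I_K -> 'I_n.+1} => mon g [ffun k => u k : nat]).
move=> a /hg[l [hl ->]].
pose red (z : F * {ffun 'I_K -> nat}) : {ffun 'I_K -> 'I_n.+1} :=
  [ffun k => inord (z.2 k)].
exists (fun u : {ffun 'I_K -> 'I_n.+1} => \sum_(z <- l | red z == u) z.1).
rewrite (partition_big red xpredT) //=; apply: eq_bigr => u _.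
rewrite scaler_suml big_seq_cond [RHS]big_seq_cond.
apply: eq_bigr => z /andP[zl /eqP<-]; congr (_ *: mon g _).
by apply/ffunP => k; rewrite !ffunE inordK // ltnS -(hl z zl) mdeg_le.
Qed.

(* For q = p^e, the factor z.1 ^+ q acts as a scalar on the e-th Frobenius root,
   so that the latter is generated in degrees bounded uniformly in e. *)
Lemma frob_gen_bound : exists D : nat, forall q n a, (0 < q)%N -> gA n a ->
  exists l : seq (A * A),
    (forall z, z \in l -> exists2 k, (k <= D * q)%N & gA k z.2) /\
    a = \sum_(z <- l) z.1 ^+ q * z.2.
Proof.
have [K [g [m [m0 gm _ hg]]]] := hgens_ex.
(* Remainders modulo q are at most q, so the sum of the degrees of the generators serves as [D]. *)
exists (\sum_k m k)%N => q n a q0 /hg[l [_ ->]].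
pose split (z : F * {ffun 'I_K -> nat}) :=
  (mon g [ffun k => z.2 k %/ q]%N, z.1 *: mon g [ffun k => z.2 k %% q]%N).
exists [seq split z | z <- l]; split.
  move=> _ /mapP[z _ ->] /=; exists (mdeg m [ffun k => z.2 k %% q]%N).
    by apply: mdeg_bound => k; rewrite ffunE ltnW // ltn_mod.
  by apply: (ngraded_scale hA); apply: ng_mon.
rewrite big_map; apply: eq_bigr => z _ /=.
by rewrite (mon_divn g z.2 q) scalerAr.
Qed.

End HomogeneousGenerators.

Lemma fg_module_fin (F : fieldType) (A : comAlgType F) (M : lmodType A)
    (J : finType) (x : J -> M) :
  (forall y, exists c : J -> A, y = \sum_j c j *: x j) -> fg_module M.
Proof.
move=> h; exists #|J|, (fun i => x (enum_val i)) => y.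
have [c ->] := h y; exists (fun i => c (enum_val i)).
by rewrite (reindex (@enum_val _ (mem J))) //; apply/onW_bij/enum_val_bij.
Qed.

Section Perfect.
Variables (F : fieldType) (p : nat) (chF : p \in [pchar F]).
Hypothesis perfF : bijective (pFrobenius_aut chF).

Lemma expq_gt0 e : (0 < p ^ e)%N.
Proof. by rewrite expn_gt0 prime_gt0 // (pcharf_prime chF). Qed.

Lemma perfect_root e (c : F) : exists b, c = b ^+ (p ^ e).
Proof.
elim: e c => [|e IHe] c; first by exists c; rewrite expr1.
have [f _ fK] := perfF; have [b cb] := IHe (f c).
by exists b; rewrite expnSr exprM -cb -(pFrobenius_autE chF) fK.
Qed.

(** The monomials with exponents below q generate. A coefficient in F is a q-th power because F is
    perfect, so it moves into the scalar. *)
Lemma frob_fg (A : comAlgType F) (gA : nat -> set A) e :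
  ngraded gA -> fg_module (frob_root A chF e).
Proof.
move=> hA; have [K [g [m [_ _ hg _]]]] := hgens_ex hA.
have q0 := expq_gt0 e; set q := (p ^ e)%N in q0 *.
have [r hr] := dependent_choice (perfect_root e).
pose I := {ffun 'I_K -> 'I_q}.
apply: (@fg_module_fin F A _ I
  (fun w : I => mon g [ffun k => w k : nat] : frob_root A chF e)) => y.
have [l ly] := hg y.
pose red (z : F * {ffun 'I_K -> nat}) : I :=
  [ffun k => Ordinal (ltn_pmod (z.2 k) q0)].
exists (fun w : I => \sum_(z <- l | red z == w)
  r z.1 *: mon g [ffun k => z.2 k %/ q]%N).
rewrite [LHS]ly (partition_big red xpredT) //=; apply: eq_bigr => w _.
rewrite scaler_suml; apply: eq_bigr => z /eqP<-.
rewrite [RHS]/(_ *: _) /= /frob_scale exprZn -hr -scalerAl.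
rewrite (mon_divn g z.2 q); congr (_ *: (_ * mon g _)).
by apply/ffunP => k; rewrite !ffunE.
Qed.

End Perfect.

(** * Graded modules *)

Section GradedMaps.
Variables (F : fieldType) (A : comAlgType F) (gA : nat -> set A).

Definition shifts (M N : lmodType A) (gM : rat -> set M) (gN : rat -> set N)
  (c : rat) (f : M -> N) := forall d x, gM d x -> gN (c + d) (f x).

(** Bundled maps are obtained up to pointwise equality, so that their packing never has to be
    unfolded. *)
Lemma linear_ex (M N : lmodType A) (f : M -> N) :
  linear f -> exists g : {linear M -> N}, g =1 f.
Proof.
move=> hf; pose L := GRing.isLinear.Build A M N *:%R f hf.
pose g : {linear M -> N} := HB.pack f L.
by exists g.
Qed.

Lemma shifts_comp (M N L : lmodType A) (gM : rat -> set M) (gN : rat -> set N)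
    (gL : rat -> set L) c d (f : M -> N) (g : N -> L) :
  shifts gM gN c f -> shifts gN gL d g -> shifts gM gL (d + c) (g \o f).
Proof. by move=> hf hg e x hx; rewrite -addrA; apply/hg/hf. Qed.

(** The component of [g y] in degree -c + d is mapped by [f] to the component of [y] in degree d,
    which is [y] itself; as [f] is injective, [g y] equals that component. *)
Lemma linear_inverse (M N : lmodType A) (gM : rat -> set M)
    (gN : rat -> set N) c (f : {linear M -> N}) :
  qgraded gA gM -> qgraded gA gN -> shifts gM gN c f -> bijective f ->
  exists g : {linear N -> M},
    [/\ cancel f g, cancel g f & shifts gN gM (- c) g].
Proof.
move=> [dM _] [dN _] hf [g fK gK].
have [g' eg] := linear_ex (can2_linear fK gK).
exists g'; split; [by move=> x; rewrite eg | by move=> x; rewrite eg |].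
move=> d y hy; rewrite eg.
have -> : g y = dproj gM (- c + d) (g y); last exact: dproj_in.
apply: (can_inj fK); rewrite gK.
have /= <- := dproj_morph dM dN (@addrI _ c) hf (- c + d) (g y).
by rewrite [f (g y)]gK (dproj_hom dN _ hy) addrA subrr add0r eqxx.
Qed.

(** Degree d of [gr_shift c gM] is degree c + d of [gM]; hence the sign in [- c]. *)
Lemma bij_gr_iso (M N : lmodType A) (gM : rat -> set M)
    (gN : rat -> set N) c (f : {linear M -> N}) :
  qgraded gA gM -> qgraded gA gN -> shifts gM gN (- c) f -> bijective f ->
  gr_iso (gr_shift c gM) gN.
Proof.
move=> qM qN hf bf; have [g [fK gK hg]] := linear_inverse qM qN hf bf.
exists f; split=> // d x; split=> [/hf|/hg]; first by rewrite addrA addNr add0r.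
by rewrite fK opprK.
Qed.

Lemma gr_iso_maps (M N : lmodType A) (gM : rat -> set M) (gN : rat -> set N) :
  gr_iso gM gN -> exists (f : {linear M -> N}) (g : {linear N -> M}),
    [/\ cancel f g, cancel g f, shifts gM gN 0 f & shifts gN gM 0 g].
Proof.
move=> [f [[g fK gK] h]].
have [g' eg] := linear_ex (can2_linear fK gK).
exists f, g'; split; [by move=> x; rewrite eg | by move=> x; rewrite eg | |].
  by move=> d x /h; rewrite add0r.
by move=> d x hx; rewrite add0r eg h gK.
Qed.

Lemma gr_dsum_maps (M N L : lmodType A) (gM : rat -> set M)
    (gN : rat -> set N) (gL : rat -> set L) :
  (forall d, gM d 0) -> (forall d, gN d 0) ->
  gr_iso (gr_dsum gM gN) gL ->
  exists (i1 : {linear M -> L}) (i2 : {linear N -> L})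
         (p1 : {linear L -> M}) (p2 : {linear L -> N}),
  [/\ cancel i1 p1, cancel i2 p2,
      (forall x, p1 (i2 x) = 0) /\ (forall x, p2 (i1 x) = 0),
      (forall x, x = i1 (p1 x) + i2 (p2 x)) &
      (shifts gM gL 0 i1 /\ shifts gN gL 0 i2) /\
      (shifts gL gM 0 p1 /\ shifts gL gN 0 p2)].
Proof.
move=> M0 N0 /gr_iso_maps[f [g [fK gK hf hg]]].
have [i1 e1] : exists i : {linear M -> L}, i =1 fun x => f (x, 0).
  apply: linear_ex => a x y; rewrite -linearP; congr (f _).
  by congr (_, _) => /=; rewrite scaler0 addr0.
have [i2 e2] : exists i : {linear N -> L}, i =1 fun x => f (0, x).
  apply: linear_ex => a x y; rewrite -linearP; congr (f _).
  by congr (_, _) => /=; rewrite scaler0 addr0.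
have [p1 e3] : exists i : {linear L -> M}, i =1 fun x => (g x).1.
  by apply: linear_ex => a x y; rewrite linearP.
have [p2 e4] : exists i : {linear L -> N}, i =1 fun x => (g x).2.
  by apply: linear_ex => a x y; rewrite linearP.
exists i1, i2, p1, p2; split.
- by move=> x; rewrite e3 e1 fK.
- by move=> x; rewrite e4 e2 fK.
- by split=> x; rewrite ?e3 ?e4 ?e1 ?e2 fK.
- move=> x; rewrite e1 e2 e3 e4 -linearD -[LHS]gK; congr (f _).
  by case: (g x) => a b; congr (_, _); rewrite /= ?addr0 ?add0r.
split; split=> d x hx; rewrite ?e1 ?e2 ?e3 ?e4.
- by apply: hf.
- by apply: hf.
- by case: (hg d x hx).
- by case: (hg d x hx).
Qed.

End GradedMaps.

(** * Splitting of idempotents of degree 0 *)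

Section FixedPoints.
Variables (F : fieldType) (A : comAlgType F).
Variables (M : lmodType A) (h : {linear M -> M}).

(** For an idempotent [h] this is its image. Being a boolean predicate, it gives a subtype that
    inherits the module structure. *)
Definition fixed : pred M := fun x => h x == x.

Lemma fixed_closed : submod_closed fixed.
Proof.
split=> [|a x y]; rewrite !unfold_in ?linear0 //.
by move=> /eqP hx /eqP hy; rewrite linearP hx hy.
Qed.

Definition fixmod : Type := {x : M | fixed x}.

HB.instance Definition _ := SubChoice.on fixmod.
HB.instance Definition _ :=
  GRing.SubChoice_isSubLmodule.Build A M fixed fixmod fixed_closed.

Definition fix_grading (gM : rat -> set M) : rat -> set fixmod :=
  fun d => [set x | gM d (val x)]%classic.

Definition to_fixed (hI : forall x, h (h x) = h x) (x : M) : fixmod :=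
  exist _ (h x) (introT eqP (hI x)).

Lemma val_to_fixed hI x : val (to_fixed hI x) = h x. Proof. by []. Qed.

Lemma fix_val (x : fixmod) : h (val x) = val x.
Proof. exact/eqP/(valP x). Qed.

End FixedPoints.

Section IdempotentSplitting.
Variables (F : fieldType) (A : comAlgType F) (gA : nat -> set A).
Variables (M : lmodType A) (gM : rat -> set M).
Hypothesis qM : qgraded gA gM.
Implicit Types h : {linear M -> M}.

Lemma fix_maps h : shifts gM gM 0 h -> (forall x, h (h x) = h x) ->
  exists (i : {linear fixmod h -> M}) (c : {linear M -> fixmod h}),
    [/\ cancel i c, forall x, i (c x) = h x, i =1 val,
      shifts (fix_grading gM) gM 0 i & shifts gM (fix_grading gM) 0 c].
Proof.
move=> hh hI.
have [i ei] : exists i : {linear fixmod h -> M}, i =1 val.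
  by apply: linear_ex => a x y; rewrite linearP.
have [c ec] : exists c : {linear M -> fixmod h}, c =1 to_fixed hI.
  by apply: linear_ex => a x y; apply: val_inj; rewrite [RHS]linearP !val_to_fixed linearP.
exists i, c; split=> //.
- by move=> x; apply: val_inj; rewrite ec val_to_fixed ei fix_val.
- by move=> x; rewrite ei ec.
- by move=> d x hx; rewrite add0r ei.
- by move=> d x hx; rewrite ec; apply: hh.
Qed.

Lemma fix_qgraded h : shifts gM gM 0 h -> (forall x, h (h x) = h x) ->
  qgraded gA (fix_grading (h := h) gM).
Proof.
move=> hh hI; have [i [c [iK cE ei hi hc]]] := fix_maps hh hI.
case: (qM) => dM sM; split; last by move=> n d a x ga gx; apply: sM.
split.
- move=> d; split=> [|x y]; rewrite !in_setE; first exact: (ds0 dM).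
  by move=> hx hy; have := dsB dM hx hy; rewrite -!ei -linearB ei.
- move=> x; have [s us [_ _ es]] := dprojP dM (i x).
  exists s, (fun d => c (dproj gM d (i x))); split=> //.
    by move=> d; have := hc _ _ (dproj_in dM d (i x)); rewrite add0r.
  by rewrite -linear_sum -es iK.
- move=> s f us hf e d sd; apply: val_inj; rewrite linear0.
  apply: (ds_indep dM us (fun d => hf d) _ sd).
  by rewrite -linear_sum e linear0.
Qed.

Lemma fix_iso h h' : shifts gM gM 0 h -> shifts gM gM 0 h' ->
  (forall x, h (h x) = h x) -> (forall x, h x + h' x = x) ->
  gr_iso (gr_dsum (fix_grading (h := h) gM) (fix_grading (h := h') gM)) gM.
Proof.
move=> sh sh' hI e.
have hh' x : h (h' x) = 0.
  by apply: (addrI (h (h x))); rewrite -linearD e hI addr0.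
have h'I x : h' (h' x) = h' x.
  by rewrite -[RHS]e hh' add0r.
have h'h x : h' (h x) = 0.
  by apply: (addrI (h (h x))); rewrite e hI addr0.
have [i [c [iK cE ei hi hc]]] := fix_maps sh hI.
have [i' [c' [iK' cE' ei' hi' hc']]] := fix_maps sh' h'I.
have [f ef] : exists f : {linear (fixmod h * fixmod h')%type -> M},
    f =1 fun x => i x.1 + i' x.2.
  apply: linear_ex => a x y /=.
  by rewrite !linearP scalerDr addrACA.
have hf x : h (f x) = i x.1.
  by rewrite ef linearD ei fix_val ei' -(fix_val x.2) hh' addr0.
have hf' x : h' (f x) = i' x.2.
  by rewrite ef linearD ei' fix_val ei -(fix_val x.1) h'h add0r.
exists f; split.
  exists (fun x => (c x, c' x)) => x.
    rewrite [RHS]surjective_pairing; congr (_, _).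
      by apply: (can_inj iK); rewrite cE hf.
    by apply: (can_inj iK'); rewrite cE' hf'.
  by rewrite ef /= cE cE' e.
move=> d x; split.
  move=> [h1 h2]; rewrite ef; apply: (dsD (proj1 qM)).
    by rewrite -[d]add0r; apply: hi.
  by rewrite -[d]add0r; apply: hi'.
move=> hx; split; rewrite /fix_grading /=.
  by rewrite -ei -hf -[d]add0r; apply: sh.
by rewrite -ei' -hf' -[d]add0r; apply: sh'.
Qed.

Lemma complement_ex h : shifts gM gM 0 h -> exists h' : {linear M -> M},
  shifts gM gM 0 h' /\ forall x, h x + h' x = x.
Proof.
move=> hh; have [h' e] : exists g : {linear M -> M}, g =1 fun x => x - h x.
  by apply: linear_ex => a x y; rewrite linearP opprD scalerBr addrACA.
exists h'; split=> [d x hx|x]; rewrite e; last by rewrite addrC subrK.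
by apply: (dsB (proj1 qM)); [rewrite add0r | apply: hh].
Qed.

(** [M] is the direct sum of the images of [h] and of 1 - h, and one of the two has to be zero. *)
Lemma indec_idem h : gr_indecomposable gA gM ->
  shifts gM gM 0 h -> (forall x, h (h x) = h x) ->
  (forall x, h x = 0) \/ (forall x, h x = x).
Proof.
move=> [_ ind] hh hI; have [h' [sh' e]] := complement_ex hh.
have h'I x : h' (h' x) = h' x.
  apply: (addrI (h (h' x))); rewrite e -[in X in X + _](addrK (h x) (h' x)).
  by rewrite [h' x + _]addrC e linearB hI subrr add0r.
case: (ind _ _ _ _ (fix_qgraded hh hI) (fix_qgraded sh' h'I)
  (fix_iso hh sh' hI e)) => h0; [left|right] => x.
  by have := congr1 val (h0 (to_fixed hI x)); rewrite val_to_fixed linear0.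
have := congr1 val (h0 (to_fixed h'I x)); rewrite val_to_fixed linear0 => h'0.
by rewrite -[RHS]e h'0 addr0.
Qed.

End IdempotentSplitting.

(** * Fitting's lemma and decompositions *)

Section PolynomialOfEndomorphism.
Variables (F : fieldType) (A : comAlgType F).
Variables (M : lmodType A) (h : {linear M -> M}).
Implicit Types P Q : {poly F}.

(** The value P(h)(x), where F acts on [M] through [A]. *)
Definition hpoly P (x : M) : M := \sum_(i < size P) (P`_i)%:A *: iter i h x.

Lemma hpoly_wide n P x : (size P <= n)%N ->
  hpoly P x = \sum_(i < n) (P`_i)%:A *: iter i h x.
Proof.
move=> hn; rewrite /hpoly (big_ord_widen n (fun i => (P`_i)%:A *: iter i h x)) //.
rewrite big_mkcond; apply: eq_bigr => i _; case: ltnP => // hi.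
by rewrite nth_default // scale0r scale0r.
Qed.

Lemma hpolyD P Q x : hpoly (P + Q) x = hpoly P x + hpoly Q x.
Proof.
have hn : (size (P + Q)%R <= maxn (size P) (size Q))%N := size_polyD P Q.
rewrite (hpoly_wide x hn) (hpoly_wide x (leq_maxl (size P) (size Q))).
rewrite (hpoly_wide x (leq_maxr (size P) (size Q))) -big_split.
by apply: eq_bigr => i _; rewrite coefD !scalerDl.
Qed.

Lemma hpoly0 x : hpoly 0 x = 0.
Proof. by rewrite /hpoly size_poly0 big_ord0. Qed.

Lemma hpolyC c x : hpoly c%:P x = c%:A *: x.
Proof. by rewrite (hpoly_wide x (size_polyC_leq1 c)) big_ord1 coefC. Qed.

Lemma hpolyMX P x : hpoly (P * 'X) x = hpoly P (h x).
Proof.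
have hn : (size (P * 'X)%R <= (size P).+1)%N.
  by have [->|P0] := eqVneq P 0; rewrite ?mul0r ?size_poly0 // size_mulX.
rewrite (hpoly_wide x hn) big_ord_recl coefMX /= scale0r scale0r add0r.
by apply: eq_bigr => i _; rewrite coefMX /= -iterSr.
Qed.

Fact hpoly_linear P : linear (hpoly P).
Proof.
move=> a x y; rewrite /hpoly scaler_sumr -big_split; apply: eq_bigr => i _ /=.
have -> : iter i h (a *: x + y) = a *: iter i h x + iter i h y.
  by elim: (i : nat) => //= n ->; rewrite linearP.
by rewrite scalerDr !scalerA [_ * a]mulrC.
Qed.

Lemma hpoly_lin_ex P : exists f : {linear M -> M}, f =1 hpoly P.
Proof. exact/linear_ex/hpoly_linear. Qed.

Lemma hpolyZl c P x : hpoly (c *: P) x = c%:A *: hpoly P x.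
Proof.
rewrite (hpoly_wide x (size_scale_leq c P)) /hpoly scaler_sumr.
by apply: eq_bigr => i _; rewrite coefZ scalerA -scalerAl mul1r scalerA.
Qed.

Lemma hpoly_h P x : hpoly P (h x) = h (hpoly P x).
Proof.
rewrite /hpoly linear_sum; apply: eq_bigr => i _.
by rewrite linearZ -iterSr iterS.
Qed.

Lemma hpolyM P Q x : hpoly (P * Q) x = hpoly P (hpoly Q x).
Proof.
elim/poly_ind: P Q x => [|P c IHP] Q x; first by rewrite mul0r !hpoly0.
rewrite mulrDl !hpolyD hpolyC -mulrA [X in hpoly (P * X)]mulrC IHP.
rewrite !hpolyMX !hpoly_h; congr (_ + _).
by rewrite mul_polyC hpolyZl.
Qed.
End PolynomialOfEndomorphism.

Lemma linear_dependence (F : fieldType) (B : finType) n (C : 'I_n -> B -> F) :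
  (#|B| < n)%N -> exists v : 'I_n -> F,
    (exists i, v i != 0) /\ forall j, \sum_i v i * C i j = 0.
Proof.
move=> hn; pose X : 'M[F]_(n, #|B|) := \matrix_(i, j) C i (enum_val j).
have : kermx X != 0.
  rewrite kermx_eq0 /row_free neq_ltn; apply/orP; left.
  exact: leq_ltn_trans (rank_leq_col X) hn.
case/rowV0Pn => v /sub_kermxP vX v0.
exists (fun i => v 0 i); split.
  apply/existsP; rewrite -negb_forall; apply: contra v0 => /forallP h.
  by apply/eqP/rowP => i; rewrite mxE; apply/eqP/h.
move=> j; have /matrixP/(_ 0 (enum_rank j)) := vX.
rewrite !mxE => e; rewrite -[RHS]e; apply: eq_bigr => i _.
by rewrite !mxE enum_rankK.
Qed.

Section FiniteGradedModules.
Variables (F : fieldType) (A : comAlgType F) (gA : nat -> set A).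
Hypothesis hA : ngraded gA.

Definition hom_gens (M : lmodType A) (gM : rat -> set M) (J : finType)
  (y : J -> M) (dg : J -> rat) :=
  (forall j, gM (dg j) (y j)) /\
  (forall x, exists c : J -> A, x = \sum_j c j *: y j).

Lemma hom_gens_ex (M : lmodType A) (gM : rat -> set M) :
  qgraded gA gM -> fg_module M -> exists J y dg, @hom_gens M gM J y dg.
Proof.
move=> [dM _] [k [x hx]].
have [t ht] : exists t : 'I_k -> seq rat, forall i,
    x i = \sum_(d <- t i) dproj gM d (x i).
  apply: (@dependent_choice _ _ (fun i t => x i = \sum_(d <- t) dproj gM d (x i))) => i.
  by have [r _ [_ _ e]] := dprojP dM (x i); exists r.
pose J := {i : 'I_k & 'I_(size (t i))}.
pose dg (j : J) := tnth (in_tuple (t (tag j))) (tagged j).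
exists J, (fun j => dproj gM (dg j) (x (tag j))), dg; split.
  by move=> j; apply: dproj_in.
move=> z; have [c ->] := hx z; exists (fun j : J => c (tag j)).
pose G i (l : 'I_(size (t i))) : M :=
  c i *: dproj gM (tnth (in_tuple (t i)) l) (x i).
rewrite -(sig_big_dep xpredT (fun=> xpredT) G) /=; apply: eq_bigr => i _.
by rewrite {1}(ht i) scaler_sumr [LHS]big_tnth.
Qed.

Lemma scale_proj (M : lmodType A) (gM : rat -> set M) a y d n :
  qgraded gA gM -> gM d y -> dproj gM (n%:R + d) (a *: y) = dproj gA n a *: y.
Proof.
move=> [dM sM] gy.
have uI : injective (fun n : nat => n%:R + d : rat).
  by move=> i j /addIr/eqP; rewrite eqr_nat => /eqP.
have [f ef] : exists f : {additive A -> M}, f =1 fun a => a *: y.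
  pose f0 (b : A) := b *: y.
  have fz : zmod_morphism f0 by move=> b c; rewrite /f0 scalerBl.
  pose L := GRing.isZmodMorphism.Build A M f0 fz.
  pose f : {additive A -> M} := HB.pack f0 L.
  by exists f.
rewrite -!ef; apply: (dproj_morph (ng_ds hA) dM uI) => i b gb.
by rewrite ef; apply: sM.
Qed.

Lemma scale_proj0 (M : lmodType A) (gM : rat -> set M) a y d e :
  qgraded gA gM -> gM d y -> (forall n : nat, e != n%:R + d) ->
  dproj gM e (a *: y) = 0.
Proof.
move=> [dM sM] gy he; have [s _ [_ _ ->]] := dprojP (ng_ds hA) a.
rewrite scaler_suml dproj_sum // big1 // => n _.
rewrite (dproj_hom dM e (sM _ _ _ _ (dproj_in (ng_ds hA) n a) gy)).
by rewrite (negPf (he n)).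
Qed.

(** A generator of degree e contributes to degree d only through A_{d-e}, which is
    finite-dimensional, if d - e is a natural number, and not at all otherwise; then [n j] takes the
    dummy value 0. *)
Lemma module_piece_fin (M : lmodType A) (gM : rat -> set M) d :
  qgraded gA gM -> fg_module M -> exists (B : finType) (b : B -> M),
    forall x, gM d x -> exists c : B -> F, x = \sum_j (c j)%:A *: b j.
Proof.
move=> qM fgM; have [J [y [dg [gy hy]]]] := hom_gens_ex qM fgM.
have [n hn] : exists n : J -> nat, forall j,
    d = (n j)%:R + dg j \/ forall k : nat, d != k%:R + dg j.
  apply: (@dependent_choice _ _
    (fun j n => d = n%:R + dg j \/ forall k : nat, d != k%:R + dg j)) => j.
  have [[k ->]|h] := pselect (exists k : nat, d = k%:R + dg j).
    by exists k; left.
  by exists 0%N; right=> k; apply: contra_notN h => /eqP ->; exists k.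
have [B hB] := dependent_choice (fun j => graded_piece_fin hA (n j)).
have [b hb] := dependent_choice hB.
exists {j : J & B j}, (fun z => b (tag z) (tagged z) *: y (tag z)) => x gx.
have [a xa] := hy x.
have hc j : exists c : B j -> F,
    dproj gM d (a j *: y j) = \sum_i (c i)%:A *: (b j i *: y j).
  have [e|e] := hn j; last first.
    rewrite (scale_proj0 _ qM (gy j) e); exists (fun=> 0).
    by rewrite big1 // => i _; rewrite !scale0r.
  rewrite {1}e (scale_proj _ _ qM (gy j)).
  have [c ->] := hb j _ (dproj_in (ng_ds hA) (n j) (a j)); exists c.
  rewrite scaler_suml; apply: eq_bigr => i _.
  by rewrite scalerA -scalerAl mul1r.
have [c hcc] := dependent_choice hc.
exists (fun z => c (tag z) (tagged z)).
pose G j (i : B j) : M := (c j i)%:A *: (b j i *: y j).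
rewrite -(sig_big_dep xpredT (fun=> xpredT) G) /=.
have := dproj_hom (proj1 qM) d gx; rewrite eqxx => <-.
by rewrite {1}xa (dproj_sum (proj1 qM)); apply: eq_bigr => j _; apply: hcc.
Qed.

(* Cayley-Hamilton in a weak form: an endomorphism of degree 0 acts on the
   finite-dimensional homogeneous pieces that contain the generators. *)
Lemma annihilating_poly (M : lmodType A) (gM : rat -> set M)
    (h : {linear M -> M}) :
  qgraded gA gM -> fg_module M -> shifts gM gM 0 h ->
  exists2 P : {poly F}, P != 0 & forall x, hpoly h P x = 0.
Proof.
move=> qM fgM hh; have [J [y [dg [gy hy]]]] := hom_gens_ex qM fgM.
have hP j : exists P : {poly F}, P != 0 /\ hpoly h P (y j) = 0.
  have [B [b hb]] := module_piece_fin (dg j) qM fgM.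
  have git i : gM (dg j) (iter i h (y j)).
    by elim: i => //= i IHi; rewrite -[dg j]add0r; apply: hh.
  (* There is one more iterate than there are spanning vectors, hence a linear relation among the
     iterates. *)
  have [C hC] := dependent_choice (fun i : 'I_#|B|.+1 => hb _ (git i)).
  have [v [[i0 vi0] hv]] := linear_dependence C (ltnSn _).
  exists (\poly_(i < #|B|.+1) v (inord i)); split.
    apply/eqP => /polyP/(_ i0); rewrite coef0 coef_poly ltn_ord inord_val.
    exact/eqP.
  rewrite (hpoly_wide h (y j) (size_poly _ _)).
  under eq_bigr => i _ do
    rewrite coef_poly ltn_ord inord_val hC scaler_sumr.
  rewrite exchange_big big1 // => k _ /=.
  under eq_bigr => i _ do rewrite scalerA -scalerAl mul1r scalerA.
  by rewrite -scaler_suml -scaler_suml hv !scale0r.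
have [P PP] := dependent_choice hP.
(* Polynomials in [h] commute, so in the product the factor [P j] may act first, and it kills
   [y j]. *)
exists (\prod_j P j); first by apply/prodf_neq0 => j _; case: (PP j).
move=> x; have [c ->] := hy x.
have [f ef] := hpoly_lin_ex h (\prod_j P j).
rewrite -ef linear_sum big1 // => j _; rewrite linearZ ef.
rewrite (bigD1 j) //= mulrC hpolyM; have [_ ->] := PP j.
have [g eg] := hpoly_lin_ex h (\prod_(i | i != j) P i).
by rewrite -eg linear0 scaler0.
Qed.

Lemma hpoly_shifts (M : lmodType A) (gM : rat -> set M) (h : {linear M -> M}) P :
  qgraded gA gM -> shifts gM gM 0 h -> shifts gM gM 0 (hpoly h P).
Proof.
move=> [dM sM] hh d x gx; apply: ds_sum => // i _.
have git : gM d (iter i h x).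
  by elim: (i : nat) => //= n IHn; rewrite -[d]add0r; apply: hh.
by rewrite -(mulr0n 1); apply: sM => //; apply: (ngraded_scale hA); apply: ng1 hA.
Qed.

(* Fitting's lemma: if X^n Q kills h with Q(0) != 0, a Bezout relation between
   X^n and Q yields an idempotent of the indecomposable module M. *)
Lemma fitting (M : lmodType A) (gM : rat -> set M) (h : {linear M -> M}) :
  qgraded gA gM -> fg_module M -> gr_indecomposable gA gM ->
  shifts gM gM 0 h -> bijective h \/ exists n, forall x, iter n h x = 0.
Proof.
move=> qM fgM indM hh; have [P P0 hP] := annihilating_poly qM fgM hh.
have [n [Q + eP]] := multiplicity_XsubC P 0; rewrite P0 /= => Q0.
have hXn m x : hpoly h 'X^m x = iter m h x.
  elim: m x => [|m IHm] x; first by rewrite expr0 hpolyC !scale1r.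
  by rewrite exprSr hpolyMX IHm -iterSr.
(* The exponent is n + 1 rather than n: if the idempotent is the identity, one factor X splits off
   and v X^n, evaluated at [h], inverts [h], also when n = 0. *)
have kill x : hpoly h (Q * 'X^(n.+1)) x = 0.
  by rewrite exprSr mulrA hpolyMX; move: eP; rewrite subr0 => <-.
have : coprimep Q 'X^(n.+1).
  by rewrite coprimep_expr // -['X]subr0 coprimep_XsubC.
case/Bezout_eq1_coprimepP => -[u v] /= uv.
have [e ee] := hpoly_lin_ex h (v * 'X^(n.+1)).
have eK x : e (hpoly h (u * Q) x) = 0.
  by rewrite ee -hpolyM mulrACA ['X^_ * Q]mulrC [_ * (Q * _)]mulrC hpolyM kill.
have eD x : hpoly h (u * Q) x + e x = x.
  by rewrite ee -hpolyD uv hpolyC !scale1r.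
have eI x : e (e x) = e x by rewrite -[x in RHS]eD linearD eK add0r.
have eh : shifts gM gM 0 e by move=> d x hx; rewrite ee; apply: hpoly_shifts.
have [e0|e1] := indec_idem qM indM eh eI; [right|left].
  exists n.+1 => x; rewrite -hXn -[x]eD e0 addr0 -hpolyM mulrC -mulrA mulrC.
  by rewrite hpolyM kill.
exists (hpoly h (v * 'X^n)) => x.
  by rewrite -hpolyMX -mulrA -exprSr -ee e1.
by rewrite -hpoly_h -hpolyMX -mulrA -exprSr -ee e1.
Qed.

(** After composition with the inverse [t] of f + g, the two maps add up to the identity. If both
    were nilpotent, the last nonzero iterate [y] of some x under t f would satisfy t g y = y,
    against the nilpotency of t g. *)
Lemma local_sum2 (M : lmodType A) (gM : rat -> set M) (f g : {linear M -> M}) :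
  qgraded gA gM -> fg_module M -> gr_indecomposable gA gM ->
  shifts gM gM 0 f -> shifts gM gM 0 g -> bijective (f \+ g) ->
  bijective f \/ bijective g.
Proof.
move=> qM fgM indM hf hg bij.
have [s es] : exists s : {linear M -> M}, s =1 f \+ g by exists (f \+ g).
have hs : shifts gM gM 0 s.
  by move=> d x hx; rewrite es; apply: (dsD (proj1 qM)); [apply: hf | apply: hg].
have bs : bijective s by apply: (eq_bij bij) => x; rewrite es.
have [t [sK tK ht]] := linear_inverse qM qM hs bs.
have ht0 : shifts gM gM 0 t by rewrite -[0]oppr0.
have htf : shifts gM gM 0 (t \o f) by rewrite -[0]addr0; apply: shifts_comp hf ht0.
have htg : shifts gM gM 0 (t \o g) by rewrite -[0]addr0; apply: shifts_comp hg ht0.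
have bt : bijective t by exists s.
have bs_of k : bijective (t \o k) -> bijective k.
  move=> b; apply: (eq_bij (f := s \o (t \o k))); first exact: bij_comp.
  by move=> x /=; rewrite tK.
have [b|[n hn]] := fitting qM fgM indM htf; first by left; apply: bs_of.
have [b|[m hm]] := fitting qM fgM indM htg; first by right; apply: bs_of.
exfalso; have [[x x0] _] := indM.
have tfg y : t (f y) + t (g y) = y by rewrite -linearD -[f y + g y]es sK.
have [k [k0 k1]] : exists k, iter k (t \o f) x != 0 /\ iter k.+1 (t \o f) x = 0.
  have ex : exists k, iter k (t \o f) x == 0 by exists n; rewrite hn.
  case: (ex_minnP ex) => -[|k] /eqP k0 kmin; first by rewrite -k0 eqxx in x0.
  exists k; split=> //; apply/negP => /kmin; by rewrite ltnn.
set y := iter k (t \o f) x in k0.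
have gy : t (g y) = y by rewrite -[RHS]tfg [t (f y)]k1 add0r.
move/eqP: k0; apply; rewrite -(hm y); elim: (m) => //= j <-.
by rewrite gy.
Qed.

Lemma local_sum (M : lmodType A) (gM : rat -> set M) (I : Type) (r : seq I)
    (f : I -> {linear M -> M}) :
  qgraded gA gM -> fg_module M -> gr_indecomposable gA gM ->
  (forall i, shifts gM gM 0 (f i)) ->
  bijective (fun x => \sum_(i <- r) f i x) -> exists i, bijective (f i).
Proof.
move=> qM fgM indM hf; elim: r => [|i r IHr] b.
  exfalso; have [[x /eqP x0] _] := indM; apply: x0; apply: (bij_inj b).
  by rewrite !big_nil.
have [g eg] : exists g : {linear M -> M}, g =1 fun x => \sum_(i <- r) f i x.
  apply: linear_ex => a x y; rewrite scaler_sumr -big_split.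
  by apply: eq_bigr => j _; rewrite linearP.
have hg : shifts gM gM 0 g.
  by move=> d x hx; rewrite eg; apply: (ds_sum (proj1 qM)) => j _; apply: hf.
have [||bg] := local_sum2 qM fgM indM (hf i) hg; last 2 first.
- by exists i.
- by apply: IHr; apply: (eq_bij bg).
by apply: (eq_bij b) => x; rewrite big_cons /= eg.
Qed.

End FiniteGradedModules.

Section Decomposition.
Variables (F : fieldType) (A : comAlgType F) (gA : nat -> set A).
Hypothesis hA : ngraded gA.
Variables (M : lmodType A) (gM : rat -> set M).
Hypothesis qM : qgraded gA gM.

(** With t the inverse of b a, the map a t b is an idempotent of [N]. It is not 0, since [M] is not,
    so it is the identity and t b is a two-sided inverse of [a]. *)
Lemma summand_indec (N : lmodType A) (gN : rat -> set N) c
    (a : {linear M -> N}) (b : {linear N -> M}) :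
  qgraded gA gN -> gr_indecomposable gA gM -> gr_indecomposable gA gN ->
  shifts gM gN c a -> shifts gN gM (- c) b -> bijective (b \o a) ->
  bijective a.
Proof.
move=> qN indM indN ha hb bij.
have hba : shifts gM gM 0 (b \o a) by rewrite -(addNr c); apply: shifts_comp ha hb.
have [t [tK Kt ht]] := linear_inverse qM qM hba bij.
pose e := a \o t \o b.
have he : shifts gN gN 0 e.
  move=> d x hx; have := ha _ _ (ht _ _ (hb _ _ hx)).
  by rewrite oppr0 add0r addrA subrr.
have eI x : e (e x) = e x by rewrite /e /= [t (b (a _))]tK.
case: (indec_idem qN indN he eI) => e0.
  exfalso; have [[x /eqP x0] _] := indM; apply: x0.
  have := e0 (a x); rewrite /e /= [t (b (a _))]tK => ax.
  by apply: (bij_inj bij); rewrite /= ax !linear0.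
by exists (t \o b) => x; [apply: tK | apply: e0].
Qed.

Definition idem_family (I : finType) (E : I -> {linear M -> M}) :=
  [/\ forall i, shifts gM gM 0 (E i), forall i x, E i (E i x) = E i x,
      forall i j x, i != j -> E i (E j x) = 0, forall x, \sum_i E i x = x
    & forall i, exists x, E i x != 0].

(** Each [E i] is nonzero at some homogeneous generator. By orthogonality these values are linearly
    independent over F, and they lie in the finitely many finite-dimensional pieces that contain the
    generators. *)
Lemma idem_family_bound : fg_module M -> exists N, forall (I : finType) E,
  @idem_family I E -> (#|I| <= N)%N.
Proof.
move=> fgM; have [J [y [dg [gy hy]]]] := hom_gens_ex qM fgM.
have [B hB] := dependent_choice (fun j => module_piece_fin hA (dg j) qM fgM).
have [b hb] := dependent_choice hB.
exists #|{: {j : J & B j}}| => I E [hE EI EO ES E0].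
have hj i : exists j, E i (y j) != 0.
  have [x] := E0 i; have [c ->] := hy x => /eqP x0.
  apply: contrapT => h; apply: x0; rewrite linear_sum big1 // => j _.
  rewrite linearZ; have -> : E i (y j) = 0; last exact: scaler0.
  by apply/eqP/negP => /negP hj; apply: h; exists j.
have [j jP] := dependent_choice hj.
rewrite leqNgt; apply/negP => lt.
pose z (k : 'I_#|I|) := E (enum_val k) (y (j (enum_val k))).
have gz k : gM (dg (j (enum_val k))) (z k).
  by rewrite -[dg _]add0r; apply: hE.
have [C hC] := dependent_choice (fun k => hb _ _ (gz k)).
(* The coordinates of [z k] are extended by 0 to the union of the spanning families; [ecast] moves
   the index into the family of the generator chosen for [k]. *)
pose C' k (t : {j : J & B j}) : F :=
  if eqVneq (tag t) (j (enum_val k)) is EqNotNeq e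
  then C k (ecast i (B i) e (tagged t)) else 0.
have hC' k : z k = \sum_t (C' k t)%:A *: b (tag t) (tagged t).
  rewrite hC; set j0 := j (enum_val k).
  pose G j (i : B j) : M := (C' k (Tagged B i))%:A *: b j i.
  transitivity (\sum_(t : {j : J & B j}) G (tag t) (tagged t)); last first.
    by apply: eq_bigr => -[].
  rewrite -(sig_big_dep xpredT (fun=> xpredT) G) /= (bigD1 j0) //=.
  rewrite [X in _ + X]big1 ?addr0 => [|j1 /negPf j10].
    apply: eq_bigr => i _; rewrite /G /C' /=; case: eqVneq => [e|]; last by rewrite eqxx.
    by rewrite (eq_axiomK e).
  apply: big1 => i _; rewrite /G /C' /=; case: eqVneq => [e|_]; last by rewrite !scale0r.
  by rewrite e eqxx in j10.
have [v [[k0 /eqP vk0] hv]] := linear_dependence C' lt; apply: vk0.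
have e0 : \sum_k (v k)%:A *: z k = 0.
  under eq_bigr => k _ do rewrite hC' scaler_sumr.
  rewrite exchange_big big1 // => t _ /=.
  under eq_bigr => k _ do rewrite scalerA -scalerAl mul1r scalerA.
  by rewrite -scaler_suml -scaler_suml hv !scale0r.
(* Applying one idempotent to the relation isolates a single term. *)
have : E (enum_val k0) (\sum_k (v k)%:A *: z k) = 0 by rewrite e0 linear0.
rewrite linear_sum (bigD1 k0) //= big1 => [|k kk0]; last first.
  by rewrite linearZ /= /z EO ?scaler0 // (inj_eq enum_val_inj) eq_sym.
rewrite addr0 linearZ /= /z EI => e1; apply/eqP/negP => /negP v0.
have /negP := jP (enum_val k0); apply; apply/eqP.
rewrite -[LHS]scale1r -[X in X *: _](scale1r (1 : A)) -(mulVf v0) -scalerA.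
by rewrite -[_ *: _%:A]mulr_algl -scalerA e1 scaler0.
Qed.

(* Splitting one member of a family that is as long as possible would give a
   longer one. *)
Lemma decomposition : fg_module M ->
  exists (I : finType) (E : I -> {linear M -> M}),
    [/\ forall i, shifts gM gM 0 (E i), forall i x, E i (E i x) = E i x,
      forall x, \sum_i E i x = x
    & forall i, gr_indecomposable gA (fix_grading (h := E i) gM)].
Proof.
move=> fgM; have [N hN] := idem_family_bound fgM.
pose Q n := `[< exists (I : finType) E, @idem_family I E /\ #|I| = n >].
have exQ : exists n, Q n.
  (* Members of a family have to be nonzero: the identity alone is a family if [M] is nonzero, and
     otherwise the empty family is taken. *)
  have [[x0 hx0]|h] := pselect (exists x : M, x <> 0).
    exists 1%N; apply/asboolP.
    have [id' eid] : exists f : {linear M -> M}, f =1 id by exists idfun.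
    exists unit, (fun=> id'); split; last exact: card_unit.
    split; first by move=> _ d x; rewrite add0r eid.
    - by move=> _ x; rewrite !eid.
    - by case; case.
    - by move=> x; rewrite (big_pred1 tt) ?eid //; case.
    - by move=> _; exists x0; rewrite eid; apply/eqP.
  exists 0%N; apply/asboolP; exists void, (of_void _).
  split; last exact: card_void.
  split; try by case.
  move=> x; rewrite big1; last by case.
  by apply: contrapT => x0; apply: h; exists x; apply: nesym.
have Qb n : Q n -> (n <= N)%N.
  by move=> /asboolP[I [E [hE <-]]]; apply: hN hE.
case: (ex_maxnP exQ Qb) => n /asboolP[I [E [hE cI]]] nmax.
have [sE EI EO ES E0] := hE; exists I, E; split=> // k.
have [i [c [iK cE ei hi hc]]] := fix_maps (sE k) (EI k).
split.
  have [x x0] := E0 k; exists (c x); apply: contra x0 => /eqP cx.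
  by rewrite -cE cx linear0.
move=> N1 N2 g1 g2 q1 q2 iso; apply: contrapT => nz.
have [n1 n2] : (exists x : N1, x <> 0) /\ (exists x : N2, x <> 0).
  split; apply: contrapT => h; apply: nz; [left|right] => x;
  by apply: contrapT => x0; apply: h; exists x.
have [u1 [u2 [p1 [p2 [uK1 uK2 [p12 p21] up [[su1 su2] [sp1 sp2]]]]]]] :=
  gr_dsum_maps (ds0 (proj1 q1)) (ds0 (proj1 q2)) iso.
(* The projections of [M] to [N1] and [N2] through the image of [E k]; together they replace [E k]
   in the longer family. *)
pose f1 : {linear M -> M} := i \o (u1 \o (p1 \o c)).
pose f2 : {linear M -> M} := i \o (u2 \o (p2 \o c)).
have f12 x : f1 x + f2 x = E k x by rewrite -cE [c x in RHS]up linearD.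
have cEk x : c (E k x) = c x by rewrite -cE iK.
have Ekf1 x : E k (f1 x) = f1 x by rewrite -cE /f1 /= iK.
have Ekf2 x : E k (f2 x) = f2 x by rewrite -cE /f2 /= iK.
have f1E x : f1 (E k x) = f1 x by rewrite /f1 /= cEk.
have f2E x : f2 (E k x) = f2 x by rewrite /f2 /= cEk.
pose E' (j : I + unit) := match j with
  | inl j => if j == k then f1 else E j | inr _ => f2 end.
suff : (n.+1 <= n)%N by rewrite ltnn.
apply: nmax; apply/asboolP; exists (I + unit)%type, E'; split; last first.
  by rewrite card_sum card_unit cI addn1.
split.
- have s1 : shifts gM gM 0 f1.
    move=> d x hx; have := hi _ _ (su1 _ _ (sp1 _ _ (hc _ _ hx))).
    by rewrite !add0r.
  have s2 : shifts gM gM 0 f2.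
    move=> d x hx; have := hi _ _ (su2 _ _ (sp2 _ _ (hc _ _ hx))).
    by rewrite !add0r.
  by case=> [j|_] //=; case: ifP.
- case=> [j|_] /= x; last by rewrite /f2 /= iK uK2.
  by case: ifP => // _; rewrite /f1 /= iK uK1.
- have f1f2 x : f1 (f2 x) = 0 by rewrite /f1 /f2 /= iK p12 !linear0.
  have f2f1 x : f2 (f1 x) = 0 by rewrite /f1 /f2 /= iK p21 !linear0.
  case=> [j|[]] [l|[]] x //=.
  + rewrite (inj_eq (@inl_inj _ _)); have [->|jk] := eqVneq j k.
      by rewrite eq_sym => /negPf lk; rewrite lk -f1E EO ?linear0 // eq_sym lk.
    have [_ _|lk jl] := eqVneq l k; last exact: EO.
    by rewrite -Ekf1 EO.
  + by move=> _; case: eqP => [_|/eqP jk]; [apply: f1f2 | rewrite -[i _]Ekf2 EO].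
  + move=> _; case: eqP => [_|/eqP jk]; first exact: f2f1.
    by have := f2E (E l x); rewrite EO 1?eq_sym // linear0 => /esym.
- move=> x; rewrite big_sumType /= (bigD1 k) //= eqxx (big_pred1 tt); last by case.
  rewrite /= addrAC f12 -[RHS]ES [RHS](bigD1 k) //=; congr (_ + _).
  by apply: eq_bigr => j /negPf ->.
- have z1 : exists x, f1 x != 0.
    have [x x0] := n1; exists (i (u1 x)); apply/eqP.
    rewrite /f1 /= iK uK1 => e; apply: x0; rewrite -[x]uK1 -[u1 x]iK e.
    by rewrite !linear0.
  have z2 : exists x, f2 x != 0.
    have [x x0] := n2; exists (i (u2 x)); apply/eqP.
    rewrite /f2 /= iK uK2 => e; apply: x0; rewrite -[x]uK2 -[u2 x]iK e.
    by rewrite !linear0.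
  by case=> [j|_] //=; case: ifP.
Qed.

End Decomposition.

(** * Frobenius roots *)

Section FrobeniusRoots.
Variables (F : fieldType) (p : nat) (chF : p \in [pchar F]).
Variables (A : comAlgType F) (gA : nat -> set A).
Hypothesis hA : ngraded gA.
Local Notation root e := (frob_root A chF e).
Local Notation groot e := (frob_root_grading chF e gA).

Lemma frob_scaleE e (a : A) (x : root e) : a *: x = a ^+ (p ^ e) * (x : A) :> A.
Proof. by []. Qed.

Lemma qdeg_inj e m n : m%:R / (p ^ e)%:R = n%:R / (p ^ e)%:R :> rat -> m = n.
Proof.
have q0 : (p ^ e)%:R != 0 :> rat by rewrite pnatr_eq0 -lt0n (expq_gt0 chF).
by move/(mulIf (invr_neq0 q0))/eqP; rewrite eqr_nat => /eqP.
Qed.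

Lemma frob_homog e n (a : A) : gA n a -> groot e (n%:R / (p ^ e)%:R) a.
Proof. by move=> ha; right; exists n. Qed.

Lemma frob_qgraded e : qgraded gA (groot e).
Proof.
have dA := ng_ds hA.
have q0 : (p ^ e)%:R != 0 :> rat by rewrite pnatr_eq0 -lt0n (expq_gt0 chF).
have zG d : zmod_closed (mem (groot e d)).
  split=> [|x y]; rewrite !in_setE; first by left.
  move=> [->|[n -> hx]]; last first.
    move=> [->|[m /qdeg_inj<- hy]]; first by right; exists n; rewrite ?subr0.
    by right; exists n => //; apply: dsB.
  move=> [->|[m -> hy]]; first by left; rewrite subr0.
  by right; exists m => //; apply: (dsB dA) => //; apply: ds0 dA _.
split.
  split=> //.
    move=> x; have [s us [_ _ es]] := dprojP dA x.
    have [t [f [ut hf ef]]] := collect_homog (r := s) zG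
      (fun n _ => frob_homog e (dproj_in dA n x)).
    by exists t, f; split=> //; rewrite {1}es.
  move=> s f us hf e0 d ds; have [//|[n dn hn]] := hf d.
  have := congr1 (dproj gA n) e0; rewrite dproj0 // (dproj_sum dA).
  rewrite (big_rem d) //= (dproj_hom dA n hn) eqxx big1_seq ?addr0 // => d' /andP[_].
  rewrite (mem_rem_uniq _ us) inE => /andP[/eqP dd' _].
  have [->|[m dm hm]] := hf d'; first exact: dproj0.
  rewrite (dproj_hom dA n hm); case: eqP => // nm.
  by case: dd'; rewrite dm dn nm.
move=> n d a x ga [->|[m -> hx]]; first by left; rewrite scaler0.
(* The scalar [a] multiplies by a^q, of degree q n; division by q turns q n + m into n + m/q. *)
right; exists (p ^ e * n + m)%N; last by apply: ngM => //; apply: ngX.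
by rewrite natrD mulrDl natrM mulrAC mulfV // mul1r.
Qed.

(** Equivalently, A^{1/q} is a graded direct summand of a finite sum of shifts of roots A^{1/p^{e'}}
    with e' in [es]; the sum itself is not formed. *)
Definition frob_factors (es : seq nat) (e : nat) :=
  exists (I : finType) (e' : I -> nat) (a : I -> rat)
    (al : forall i, {linear root e -> root (e' i)})
    (be : forall i, {linear root (e' i) -> root e}),
  [/\ forall i, e' i \in es,
      forall i, shifts (groot e) (groot (e' i)) (a i) (al i),
      forall i, shifts (groot (e' i)) (groot e) (- a i) (be i)
    & forall x, \sum_i be i (al i x) = x].

(** The finite set consists of the members of one chosen decomposition of A^{1/p^{e_0}} for each e_0
    in [es]. The identity of [M] is a sum over the factors k, and one term is bijective; this term
    is split along the decomposition of the root it passes through, and again one term is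
    bijective. *)
Lemma FFRT_intro : bijective (pFrobenius_aut chF) -> reduced A ->
  (exists es, forall e, frob_factors es e) -> FFRT chF gA.
Proof.
move=> perfF redA [es hes]; split=> //.
have dec e := decomposition hA (frob_qgraded e) (frob_fg perfF e hA).
have [I0 hI] := dependent_choice dec; have [E hE] := dependent_choice hI.
pose ex (i : 'I_(size es)) := nth 0%N es i.
pose T := {i : 'I_(size es) & I0 (ex i)}.
pose L0 (t : T) := fixmod (E (ex (tag t)) (tagged t)).
pose g0 (t : T) : rat -> set (L0 t) := fix_grading (groot (ex (tag t))).
exists #|{: T}|, (fun i => L0 (enum_val i)), (fun i => g0 (enum_val i)).
have qg t : qgraded gA (g0 t).
  have [sE EI _ _] := hE (ex (tag t)).
  by apply: fix_qgraded; [apply: frob_qgraded | apply: sE | apply: EI].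
split=> [i|e M gM qM fgM indM [N [gN [qN iso]]]]; first exact: qg.
have [i1 [_ [p1 [_ [iK _ _ _ [[si _] [sp _]]]]]]] :=
  gr_dsum_maps (ds0 (proj1 qM)) (ds0 (proj1 qN)) iso.
have [I [e' [a [al [be [he sal sbe eid]]]]]] := hes e.
pose f k : {linear M -> M} := p1 \o (be k \o (al k \o i1)).
have sf k : shifts gM gM 0 (f k).
  move=> d x hx; have := sp _ _ (sbe k _ _ (sal k _ _ (si _ _ hx))).
  by rewrite !add0r addrA addNr add0r.
have [k bk] : exists k, bijective (f k).
  apply: (local_sum hA qM fgM indM sf (r := index_enum I)).
  by exists id => x; rewrite -linear_sum eid iK.
have [sE EI ES indE] := hE (e' k).
pose f' l : {linear M -> M} := p1 \o (be k \o (E (e' k) l \o (al k \o i1))).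
have sf' l : shifts gM gM 0 (f' l).
  move=> d x hx.
  have := sp _ _ (sbe k _ _ (sE l _ _ (sal k _ _ (si _ _ hx)))).
  by rewrite !add0r addrA addNr add0r.
have [l bl] : exists l, bijective (f' l).
  apply: (local_sum hA qM fgM indM sf' (r := index_enum (I0 (e' k)))).
  by apply: (eq_bij bk) => x; rewrite -!linear_sum ES.
have [i [c [ciK cE ei hi hc]]] := fix_maps (sE l) (EI l).
have kes : (index (e' k) es < size es)%N by rewrite index_mem.
have exk : ex (Ordinal kes) = e' k by rewrite /ex nth_index.
have [t [cc isot]] : exists (t : T) cc, gr_iso (gr_shift cc gM) (g0 t).
  (* The index is quantified before the rewriting with [exk], because its type depends on the
     exponent. *)
  suff : exists (l : I0 (ex (Ordinal kes))) cc,
      gr_iso (gr_shift cc gM) (g0 (Tagged (fun i => I0 (ex i)) l)).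
    by move=> [l' [cc h]]; exists (Tagged (fun i => I0 (ex i)) l'), cc.
  rewrite /g0 /L0 /= exk; exists l, (- a k).
  pose a1 : {linear M -> fixmod (E (e' k) l)} := c \o (al k \o i1).
  pose b1 : {linear fixmod (E (e' k) l) -> M} := p1 \o (be k \o i).
  have sa : shifts gM (fix_grading (groot (e' k))) (a k) a1.
    move=> d x hx; have := hc _ _ (sal k _ _ (si _ _ hx)).
    by rewrite !add0r.
  have sb : shifts (fix_grading (groot (e' k))) gM (- a k) b1.
    move=> d x hx; have := sp _ _ (sbe k _ _ (hi _ _ hx)).
    by rewrite !add0r.
  have qf : qgraded gA (fix_grading (h := E (e' k) l) (groot (e' k))).
    by apply: fix_qgraded; [apply: frob_qgraded | apply: sE | apply: EI].
  apply: (bij_gr_iso (f := a1) qM qf); first by rewrite opprK.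
  apply: (summand_indec qM qf indM (indE l) sa sb).
  by apply: (eq_bij bl) => x; rewrite /= cE.
by exists (enum_rank t), cc; rewrite enum_rankK.
Qed.

Definition integral_support (M : lmodType A) (gM : rat -> set M) :=
  forall d d' x y, gM d x -> gM d' y -> x != 0 -> y != 0 ->
    exists z : int, d' - d = z%:~R.

(* The projection to the degrees in a coset of the integers commutes with the
   action of A. *)
Lemma indec_integral (M : lmodType A) (gM : rat -> set M) :
  qgraded gA gM -> gr_indecomposable gA gM -> integral_support gM.
Proof.
move=> qM indM d d' x y hx hy x0 y0; have [dM sM] := qM.
pose P (c : rat) := `[< exists z : int, c - d = z%:~R >].
have PD (n : nat) c : P (n%:R + c) = P c.
  apply/asboolP/asboolP => -[z hz].
    exists (z - n%:Z); rewrite rmorphB /= -hz -pmulrn.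
    by rewrite -[n%:R + c - d]addrA [n%:R + _]addrC addrK.
  by exists (n%:Z + z); rewrite rmorphD /= -hz -pmulrn addrA.
have ext u v : (forall c, dproj gM c u = dproj gM c v) -> u = v.
  move=> h; apply/eqP; rewrite -subr_eq0; apply/eqP/(dproj_eq0 dM) => c.
  apply: (addIr (dproj gM c v)).
  by rewrite -(dprojD dM) subrK add0r h.
have hpi u : exists v, forall c, dproj gM c v = if P c then dproj gM c u else 0.
  have [s us [_ s0 es]] := dprojP dM u.
  exists (\sum_(c <- s | P c) dproj gM c u) => c.
  rewrite (dproj_sum dM).
  under eq_bigr => c' _ do
    rewrite (dproj_hom dM c (dproj_in dM c' u)) eq_sym.
  rewrite -big_mkcondr /=.
  have [sc|sc] := boolP (c \in s); last first.
    rewrite s0 // if_same big1_seq // => c' /andP[/andP[_ /eqP ->] cs].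
    by rewrite s0.
  rewrite (big_rem c) //= eqxx andbT big1_seq ?addr0 // => c'.
    by move=> /andP[/andP[_ /eqP->]]; rewrite mem_rem_uniqF.
have [f hf] := dependent_choice hpi.
have fD u v : f (u + v) = f u + f v.
  apply: ext => c; rewrite (dprojD dM) !hf (dprojD dM).
  by case: ifP => // _; rewrite addr0.
have fZ a u : f (a *: u) = a *: f u.
  have [r _ [hr _ ->]] := dprojP (ng_ds hA) a.
  have f0 : f 0 = 0 by apply: (addrI (f 0)); rewrite -fD !addr0.
  rewrite !scaler_suml (big_morph f fD f0); apply: eq_bigr => n _.
  set b := dproj gA n a.
  have uI : injective (fun c : rat => n%:R + c) by apply: addrI.
  have prb w c : dproj gM c (b *: w) = b *: dproj gM (c - n%:R) w.
    have := dproj_morph (f := *:%R b) dM dM uI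
      (fun i x => sM n i b x (hr n)) (c - n%:R) w.
    by rewrite /= [n%:R + _]addrC subrK.
  apply: ext => c; rewrite hf !prb hf -(PD n (c - n%:R)) [n%:R + _]addrC subrK.
  by case: ifP => // _; rewrite scaler0.
have [g eg] : exists g : {linear M -> M}, g =1 f.
  by apply: linear_ex => a u v; rewrite fD fZ.
have sg : shifts gM gM 0 g.
  move=> c u hu; rewrite add0r eg.
  have -> : f u = if P c then u else 0.
    apply: ext => c'; rewrite hf (dproj_hom dM c' hu).
    have [->|/negPf cc] := eqVneq c' c.
      case: (P c); last by rewrite dproj0.
      by rewrite (dproj_hom dM c hu) eqxx.
    rewrite if_same; case: (P c); last by rewrite dproj0.
    by rewrite (dproj_hom dM c' hu) cc.
  by case: (P c) => //; apply: ds0.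
have gI u : g (g u) = g u.
  rewrite !eg; apply: ext => c; rewrite hf hf.
  by case: (P c).
have Pd : P d by apply/asboolP; exists 0; rewrite subrr.
have [g0|g1] := indec_idem qM indM sg gI.
  case/eqP: x0; have := congr1 (dproj gM d) (g0 x).
  by rewrite eg hf Pd (dproj_hom dM d hx) eqxx dproj0.
have := congr1 (dproj gM d') (g1 y); rewrite eg hf (dproj_hom dM d' hy) eqxx.
case: ifP => [/asboolP//|_ e]; by rewrite -e eqxx in y0.
Qed.

(** Up to a shift, [L] is a graded summand of A^{1/p^e}; the number [a] is the degree of the
    projection onto it. *)
Definition occurs (L : lmodType A) (gL : rat -> set L) (e : nat) (a : rat) :=
  exists (al : {linear root e -> L}) (be : {linear L -> root e}),
    [/\ shifts (groot e) gL a al, shifts gL (groot e) (- a) be & cancel be al].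

(** A^{1/q} is generated in degrees from 0 to D, so [L] has a nonzero element u of degree at most a
    + D. Its image under the injective map be' is nonzero, hence of degree at least 0, which means
    that u has degree at least a'. *)
Lemma occurs_bound : exists D : nat, forall (L : lmodType A) (gL : rat -> set L)
    e a e' a', (exists x : L, x != 0) -> occurs gL e a -> occurs gL e' a' ->
  a' <= a + D%:R.
Proof.
have [D hD] := frob_gen_bound hA; exists D => L gL e a e' a' [x x0].
move=> [al [be [sa sb ab]]] [al' [be' [sa' sb' ab']]].
have q0 := expq_gt0 chF e.
have [d [u [[k kD dk] hu u0]]] : exists d u,
    [/\ exists2 k, (k <= D * p ^ e)%N & d = a + k%:R / (p ^ e)%:R,
       gL d u & u != 0].
  (* If [al] killed all generators of the root, it would be 0, against x = al (be x) with x
     nonzero. *)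
  apply: contrapT => h; case/eqP: x0; rewrite -(ab x).
  have [s _ [hs _ ->]] := dprojP (ng_ds hA) (be x : A).
  rewrite linear_sum big1 // => n _.
  have [l [hl ->]] := hD _ _ _ q0 (hs n).
  have -> : \sum_(z <- l) z.1 ^+ (p ^ e) * z.2 =
    \sum_(z <- l) z.1 *: (z.2 : root e) by [].
  rewrite linear_sum big_seq big1 // => z /hl[k kD hk].
  rewrite linearZ; have -> : al (z.2 : root e) = 0; last exact: scaler0.
  apply/eqP/negP => /negP z0; apply: h.
  exists (a + k%:R / (p ^ e)%:R), (al (z.2 : root e)); split=> //.
    by exists k.
  exact/sa/frob_homog.
have b0 : be' u != 0 by apply: contra u0 => /eqP bu; rewrite -(ab' u) bu linear0.
have [b1|[n dn _]] := sb' _ _ hu; first by rewrite b1 eqxx in b0.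
have : 0 <= - a' + d by rewrite dn divr_ge0 ?ler0n.
rewrite addrC subr_ge0 dk => /le_trans; apply; rewrite lerD2l.
by rewrite ler_pdivrMr ?ltr0n // -natrM ler_nat.
Qed.

(** Being nonzero with integral support is asked of the modules that occur in some root, because the
    list in [FFRT] may contain others. *)
Definition FFRT_modules (k : nat) (L : 'I_k -> lmodType A)
    (gL : forall i, rat -> set (L i)) :=
  forall e, exists (I : finType) (t : I -> 'I_k) (a : I -> rat)
    (al : forall i, {linear root e -> L (t i)})
    (be : forall i, {linear L (t i) -> root e}),
  [/\ forall i, shifts (groot e) (gL (t i)) (a i) (al i),
      forall i, shifts (gL (t i)) (groot e) (- a i) (be i),
      forall i, cancel (be i) (al i),
      forall i, integral_support (gL (t i)) /\ (exists x : L (t i), x != 0)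
    & forall x, \sum_i be i (al i x) = x].

(** The clauses on [L (t i)] are carried over from an indecomposable summand of A^{1/q} along the
    isomorphism that [FFRT] provides. *)
Lemma FFRT_elim : bijective (pFrobenius_aut chF) -> FFRT chF gA ->
  exists k (L : 'I_k -> lmodType A) gL, @FFRT_modules k L gL.
Proof.
move=> perfF [_ _ [k [L [gL [qL hL]]]]]; exists k, L, gL => e.
have qe := frob_qgraded e; have fge := frob_fg perfF e hA.
have [I [E [sE EI ES indE]]] := decomposition hA qe fge.
have hi (i : I) : exists (t : 'I_k) (a : rat) (al : {linear root e -> L t})
    (be : {linear L t -> root e}),
    [/\ shifts (groot e) (gL t) a al, shifts (gL t) (groot e) (- a) be,
       cancel be al, integral_support (gL t) /\ (exists x : L t, x != 0)
     & forall x, be (al x) = E i x].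
  have qf := fix_qgraded qe (sE i) (EI i).
  have [u [c [uK cE eu su sc]]] := fix_maps (sE i) (EI i).
  have fgf : fg_module (fixmod (E i)).
    have [n [y hy]] := fge; exists n, (fun j => c (y j)) => z.
    have [b eb] := hy (u z); exists b; rewrite -[LHS]uK eb linear_sum.
    by apply: eq_bigr => j _; rewrite linearZ.
  have [h [sh eh]] := complement_ex qe (sE i).
  have hI x : h (h x) = h x.
    have Eh : E i (h x) = 0.
      by apply: (addrI (E i (E i x))); rewrite -linearD eh EI addr0.
    by rewrite -[RHS]eh Eh add0r.
  have [|t [a iso]] := hL e _ _ qf fgf (indE i).
    exists (fixmod h), (fix_grading (groot e)); split; first exact: fix_qgraded.
    exact: (fix_iso qe (sE i) sh (EI i) eh).
  have [f [g [fK gK sf sg]]] := gr_iso_maps iso.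
  have sf' : shifts (fix_grading (groot e)) (gL t) (- a) f.
    move=> d x hx; have := sf (- a + d) x; rewrite add0r; apply.
    by rewrite /gr_shift addrA subrr add0r.
  have sg' : shifts (gL t) (fix_grading (groot e)) a g.
    by move=> d x /sg; rewrite add0r.
  exists t, (- a), (f \o c), (u \o g); split.
  - by move=> d x hx; have := sf' _ _ (sc _ _ hx); rewrite add0r.
  - by move=> d x hx; rewrite opprK; have := su _ _ (sg' _ _ hx); rewrite add0r.
  - by move=> x /=; rewrite uK gK.
  - split; last first.
      have [[x x0] _] := indE i; exists (f x); apply: contra x0 => /eqP fx.
      by rewrite -(fK x) fx linear0.
    move=> d d' x y /sg' hx /sg' hy x0 y0.
    have nz w : w != 0 -> g w != 0.
      by apply: contra => /eqP gw; rewrite -(gK w) gw linear0.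
    have [z ez] := indec_integral qf (indE i) hx hy (nz _ x0) (nz _ y0).
    by exists z; rewrite -ez opprD addrACA subrr add0r.
  - by move=> x; rewrite /= fK cE.
have [t ht] := dependent_choice hi; have [a ha] := dependent_choice ht.
have [al hal] := dependent_choice ha; have [be hbe] := dependent_choice hal.
exists I, t, a, al, be; split=> [i|i|i|i|x]; try by case: (hbe i).
by rewrite -[RHS]ES; apply: eq_bigr => i _; case: (hbe i).
Qed.

End FrobeniusRoots.

(** * Tensor products *)

(** Zorn's lemma gives a maximal subspace [K] that meets [W] in 0. Every x lies in W + K, since
    otherwise K + F x would be larger and still meet [W] in 0. *)
Lemma complement_proj (F : fieldType) (V : lmodType F) (W : {pred V}) :
  submod_closed W -> exists f : {linear V -> V},
    (forall x, f x \in W) /\ {in W, forall x, f x = x}.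
Proof.
move=> [W0 WL].
have WB x y : x \in W -> y \in W -> x - y \in W.
  by move=> hx hy; rewrite addrC -scaleN1r; apply: WL.
pose sub (C : set V) := [/\ C 0, forall a x y, C x -> C y -> C (a *: x + y)
  & forall x, C x -> x \in W -> x = 0].
pose le (C D : {C : set V | sub C}) :=
  `[< forall x, proj1_sig C x -> proj1_sig D x >].
have [C maxC] : exists C, forall D, le C D -> D = C.
  apply: (@Zorn _ le).
  - by move=> C; apply/asboolP.
  - move=> C D E /asboolP h /asboolP k; apply/asboolP => x /h; exact: k.
  - move=> [C hC] [D hD] /asboolP h /asboolP k; apply: eq_exist => /=.
    by apply/seteqP; split.
  move=> X tot.
  (* The vector 0 is adjoined for the sake of the empty chain. *)
  pose U : set V := fun x => x = 0 \/ exists C, X C /\ proj1_sig C x.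
  have hU : sub U.
    split; first by left.
      move=> a x y [->|[C [XC Cx]]] [->|[D [XD Dy]]].
      - by left; rewrite scaler0 addr0.
      - by rewrite scaler0 add0r; right; exists D.
      - right; exists C; split=> //; have [C0 CL _] := proj2_sig C.
        by apply: CL.
      right; case: (tot _ _ XC XD) => /asboolP h.
        by exists D; split=> //; have [_ DL _] := proj2_sig D; apply: DL => //; apply: h.
      by exists C; split=> //; have [_ CL _] := proj2_sig C; apply: CL => //; apply: h.
    move=> x [//|[C [XC Cx]]]; have [_ _ CW] := proj2_sig C; exact: CW.
  exists (exist _ U hU) => C XC; apply/asboolP => x Cx; right; by exists C.
pose K := proj1_sig C; have [K0 KL KW] : sub K := proj2_sig C.
have KB x y : K x -> K y -> K (x - y).
  by move=> hx hy; rewrite addrC -scaleN1r; apply: KL.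
have cov x : exists w, w \in W /\ K (x - w).
  apply: contrapT => nx.
  pose D : set V := fun z => exists a c, K c /\ z = a *: x + c.
  have hD : sub D.
    split.
    - by exists 0, 0; rewrite scale0r addr0.
    - move=> a _ _ [b [c [Cc ->]]] [b' [c' [Cc' ->]]].
      exists (a * b + b'), (a *: c + c'); split; first exact: KL.
      by rewrite scalerDr scalerA scalerDl addrACA.
    - move=> _ [a [c [Cc ->]]] hW; have [a0|a0] := eqVneq a 0.
        by move: hW; rewrite a0 scale0r add0r; apply: KW.
      case: nx; exists (a^-1 *: (a *: x + c)); split.
        by rewrite -[_ *: _]addr0; apply: WL.
      rewrite scalerDr scalerA mulVf // scale1r opprD addrA subrr add0r.
      by rewrite -scalerN -[_ *: _]addr0; apply: KL => //; rewrite -[- c]add0r; apply: KB.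
  have le_CD : le C (exist _ D hD).
    by apply/asboolP => z Cz /=; exists 0, z; rewrite scale0r add0r.
  apply: nx; exists 0; split=> //; rewrite subr0 /K -(maxC _ le_CD) /=.
  by exists 1, 0; rewrite scale1r addr0.
have [f hf] := dependent_choice cov.
have uniq x w : w \in W -> K (x - w) -> f x = w.
  move=> hw Cw; have [fW Cf] := hf x.
  apply/eqP; rewrite -subr_eq0; apply/eqP/KW; last exact: WB.
  by have := KB _ _ Cw Cf; rewrite opprB addrC addrA subrK.
have [g eg] : exists g : {linear V -> V}, g =1 f.
  have hl : linear f.
    move=> a x y; have [fx Cx] := hf x; have [fy Cy] := hf y.
    apply: uniq; first exact: WL.
    by have := KL a _ _ Cx Cy; rewrite scalerBr opprD addrACA.
  pose L := GRing.isLinear.Build F V V *:%R f hl.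
  pose g : {linear V -> V} := HB.pack f L.
  by exists g.
exists g; split=> [x|x hx]; rewrite eg; first by case: (hf x).
by apply: uniq => //; rewrite subrr.
Qed.

Section Twist.
Variables (F : fieldType) (V : lmodType F) (sg : {rmorphism F -> F}).

(** A linear map into the twist is an [sg]-semilinear map into [V]; this brings semilinear maps
    under the universal property of the tensor product. *)
Definition twist of {rmorphism F -> F} : Type := V.
Local Notation tw := (twist sg).

HB.instance Definition _ := GRing.Zmodule.on tw.

Definition twist_scale (c : F) (v : tw) : tw := sg c *: (v : V).

Fact twist_scaleA (a b : F) (v : tw) :
  twist_scale a (twist_scale b v) = twist_scale (a * b) v.
Proof. by rewrite /twist_scale scalerA rmorphM. Qed.

Fact twist_scale1 : left_id 1 twist_scale.
Proof. by move=> v; rewrite /twist_scale rmorph1 scale1r. Qed.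

Fact twist_scaleDr : right_distributive twist_scale +%R.
Proof. by move=> a u v; rewrite /twist_scale -scalerDr. Qed.

Fact twist_scaleDl (v : tw) : {morph twist_scale^~ v : a b / a + b}.
Proof. by move=> a b; rewrite /twist_scale rmorphD scalerDl. Qed.

HB.instance Definition _ := GRing.Zmodule_isLmodule.Build F tw
  twist_scaleA twist_scale1 twist_scaleDr twist_scaleDl.

End Twist.

Section Tensor.
Variables (F : fieldType) (R S T : comAlgType F).
Variables (iR : {lrmorphism R -> T}) (iS : {lrmorphism S -> T}).
Hypothesis hT : is_tensor iR iS.
Local Notation "r %t s" := (iR r * iS s) (at level 40).

Lemma tensorZ c r s : (c *: r) %t s = c *: (r %t s).
Proof. by rewrite linearZ scalerAl. Qed.

Lemma tensor_semilinear (sg : {rmorphism F -> F}) (f : R -> R) (g : S -> S) :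
  (forall c x y, f (c *: x + y) = sg c *: f x + f y) ->
  (forall c x y, g (c *: x + y) = sg c *: g x + g y) ->
  exists H : {additive T -> T}, forall r s, H (r %t s) = f r %t g s.
Proof.
move=> hf hg; have [] := @hT (twist T sg) (fun r s => f r %t g s).
- move=> r c x y; rewrite hg linearD linearZ mulrDr.
  by rewrite -scalerAr.
- by move=> s c x y; rewrite hf linearD linearZ mulrDl -scalerAl.
move=> H hH _.
have zH : zmod_morphism (H : T -> T) by move=> x y; rewrite linearB.
pose L := GRing.isZmodMorphism.Build T T (H : T -> T) zH.
pose H' : {additive T -> T} := HB.pack (H : T -> T) L.
by exists H'.
Qed.

(** A linear projection of [T] onto the span of the pure tensors agrees with the identity on these,
    hence everywhere, by the uniqueness in the universal property. *)
Lemma tensor_span t : exists l : seq (R * S), t = \sum_(z <- l) z.1 %t z.2.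
Proof.
pose W : {pred T} := fun t => `[< exists l : seq (R * S),
  t = \sum_(z <- l) z.1 %t z.2 >].
have WP : submod_closed W.
  split; first by apply/asboolP; exists [::]; rewrite big_nil.
  move=> c _ _ /asboolP[l ->] /asboolP[l' ->]; apply/asboolP.
  exists ([seq (c *: z.1, z.2) | z <- l] ++ l').
  rewrite big_cat big_map scaler_sumr; congr (_ + _).
  by apply: eq_bigr => z _; rewrite tensorZ.
have [f [fW fid]] := complement_proj WP.
have [] := @hT T (fun r s => r %t s).
- by move=> r c x y; rewrite linearD linearZ mulrDr -scalerAr.
- by move=> s c x y; rewrite linearD linearZ mulrDl -scalerAl.
move=> g _ gU.
have ef : f =1 g.
  apply: gU => r s; apply: fid; apply/asboolP; exists [:: (r, s)].
  by rewrite big_seq1.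
have [i ei] : exists i : {linear T -> T}, i =1 id by exists idfun.
have eg : i =1 g by apply: gU => r s; rewrite ei.
by have /asboolP := fW t; rewrite ef -eg ei.
Qed.

End Tensor.

Section TensorAlgebra.
Variables (F : fieldType) (R S T : comAlgType F).
Variables (iR : {lrmorphism R -> T}) (iS : {lrmorphism S -> T}).
Hypothesis hT : is_tensor iR iS.
Variables (gR : nat -> set R) (gS : nat -> set S).
Hypotheses (hR : ngraded gR) (hS : ngraded gS).
Local Notation "r %t s" := (iR r * iS s) (at level 40).
Local Notation gT := (tensor_grading iR iS gR gS).

Lemma tensor_sumsP (P : R -> S -> Prop) t : tensor_sums iR iS P t <->
  exists l : seq (R * S), (forall z, z \in l -> P z.1 z.2) /\
    t = \sum_(z <- l) z.1 %t z.2.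
Proof.
split=> [[k [r [s [hP ->]]]]|[l [hl ->]]].
  exists [seq (r i, s i) | i <- enum 'I_k]; split.
    by move=> _ /mapP[i _ ->]; apply: hP.
  by rewrite big_map enumT.
exists (size l), (fun i => (tnth (in_tuple l) i).1),
  (fun i => (tnth (in_tuple l) i).2); split.
  by move=> i; apply/hl/mem_tnth.
by rewrite big_tnth.
Qed.

Lemma tensor_sums_sub (P : R -> S -> Prop) t u :
  (forall r s, P r s -> P (- r) s) ->
  tensor_sums iR iS P t -> tensor_sums iR iS P u -> tensor_sums iR iS P (t - u).
Proof.
move=> hP /tensor_sumsP[l [hl ->]] /tensor_sumsP[l' [hl' ->]].
apply/tensor_sumsP; exists (l ++ [seq (- z.1, z.2) | z <- l']); split.
  by move=> z; rewrite mem_cat => /orP[/hl//|/mapP[w /hl' hw ->]]; apply: hP.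
rewrite big_cat big_map -sumrN; congr (_ + _).
by apply: eq_bigr => z _; rewrite linearN mulNr.
Qed.

Lemma tensor_sums1 (P : R -> S -> Prop) r s : P r s ->
  tensor_sums iR iS P (r %t s).
Proof.
move=> h; apply/tensor_sumsP; exists [:: (r, s)]; rewrite big_seq1.
by split=> // z; rewrite inE => /eqP ->.
Qed.

Lemma tensor_homog t : exists l : seq ((nat * nat) * (R * S)),
  (forall z, z \in l -> gR z.1.1 z.2.1 /\ gS z.1.2 z.2.2) /\
  t = \sum_(z <- l) z.2.1 %t z.2.2.
Proof.
have [l ->] := tensor_span hT t; elim: l => [|[r s] l [m [hm em]]].
  by exists [::]; rewrite !big_nil.
have [a _ [ha _ ea]] := dprojP (ng_ds hR) r.
have [b _ [hb _ eb]] := dprojP (ng_ds hS) s.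
pose tm i j := ((i, j), (dproj gR i r, dproj gS j s)).
exists ([seq tm i j | i <- a, j <- b] ++ m); split.
  move=> z; rewrite mem_cat => /orP[|/hm//].
  by case/allpairsP => -[i j] /= [_ _ ->].
rewrite big_cons big_cat /= em; congr (_ + _).
rewrite {1}ea {1}eb !linear_sum big_distrlr big_allpairs_dep.
by [].
Qed.

(** The universal property gives the projections to total degree n before the grading of [T] is
    known to be direct; applying them to a vanishing sum is what proves the independence of the
    components. *)
Lemma tensor_proj : exists P : nat -> {linear T -> T}, forall n r s,
  P n (r %t s) = \sum_(i < n.+1) dproj gR i r %t dproj gS (n - i)%N s.
Proof.
apply: (@dependent_choice nat _ (fun n (P : {linear T -> T}) => forall r s,
  P (r %t s) = \sum_(i < n.+1) dproj gR i r %t dproj gS (n - i)%N s)) => n.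
have prZ (A : comAlgType F) (gA : nat -> set A) i (c : F) a b : ngraded gA ->
    dproj gA i (c *: a + b) = c *: dproj gA i a + dproj gA i b.
  move=> hA; rewrite (dprojD (ng_ds hA)); congr (_ + _).
  have sc k x : gA k x -> gA (id k) (c *: x) by apply: ngraded_scale.
  have /= <- := dproj_morph (f := *:%R c) (ng_ds hA) (ng_ds hA) (@inj_id nat) sc i a.
  by [].
have [] := @hT T (fun r s => \sum_(i < n.+1) dproj gR i r %t dproj gS (n - i)%N s).
- move=> r c x y; rewrite scaler_sumr -big_split; apply: eq_bigr => i _.
  by rewrite prZ // linearD linearZ mulrDr -scalerAr.
- move=> s c x y; rewrite scaler_sumr -big_split; apply: eq_bigr => i _.
  by rewrite prZ // linearD linearZ mulrDl -scalerAl.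
by move=> g hg _; exists g.
Qed.

Lemma tensor_gradingP n t : gT n t <-> exists l : seq (R * S),
  (forall z, z \in l -> exists i j, [/\ (i + j)%N = n, gR i z.1 & gS j z.2]) /\
  t = \sum_(z <- l) z.1 %t z.2.
Proof. exact: tensor_sumsP. Qed.

Lemma tensor_gr_mul i j r s : gR i r -> gS j s -> gT (i + j)%N (r %t s).
Proof. by move=> hr hs; apply: tensor_sums1; exists i, j. Qed.

Lemma tensor_ds : direct_sum gT.
Proof.
have zG i : zmod_closed (mem (gT i)).
  split=> [|x y]; rewrite !in_setE.
    by apply/tensor_gradingP; exists [::]; rewrite big_nil.
  apply: tensor_sums_sub => r s [j [k [jk rj sk]]]; exists j, k; split=> //.
  by rewrite -scaleN1r; apply: (ngraded_scale hR).
split=> // [t|s f us hf e].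
  have [l [hl ->]] := tensor_homog t.
  have [|s [f [us hf ef]]] := @collect_homog _ _ _ gT l (fun z => (z.1.1 + z.1.2)%N)
    (fun z => z.2.1 %t z.2.2) zG; last by exists s, f.
  by move=> z /hl[h1 h2]; apply: tensor_gr_mul.
have [P hP] := tensor_proj.
have PE n m t : gT m t -> P n t = if m == n then t else 0.
  move/tensor_gradingP=> [l [hl ->]]; rewrite linear_sum.
  have [<-|/negPf mn] := eqVneq m n.
    apply: eq_big_seq => z /hl[i [j [ij hi hj]]]; rewrite hP.
    have im : (i < m.+1)%N by rewrite -ij ltnS leq_addr.
    rewrite (bigD1 (Ordinal im)) //= big1 ?addr0 => [|k /eqP ki].
      rewrite (dproj_hom (ng_ds hR) _ hi) eqxx (dproj_hom (ng_ds hS) _ hj).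
      by rewrite /= -ij addKn eqxx.
    rewrite (dproj_hom (ng_ds hR) _ hi); case: eqP => [e1|_].
      by case: ki; apply: val_inj.
    by rewrite linear0 mul0r.
  rewrite big_seq big1 // => z /hl[i [j [ij hi hj]]]; rewrite hP big1 // => k _.
  rewrite (dproj_hom (ng_ds hR) _ hi) (dproj_hom (ng_ds hS) _ hj).
  case: eqP => [ki|_]; last by rewrite linear0 mul0r.
  case: eqP => [kj|_]; last by rewrite linear0 mulr0.
  have := ltn_ord k; rewrite ltnS => kn.
  by rewrite -ij -kj -ki subnKC // eqxx in mn.
move=> i si; have := congr1 (P i) e; rewrite linear0 linear_sum.
rewrite (big_rem i) //= (PE _ _ _ (hf i)) eqxx big1_seq ?addr0 // => j /andP[_].
rewrite (mem_rem_uniq _ us) inE => /andP[ji _].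
by rewrite (PE _ _ _ (hf j)) (negPf ji).
Qed.

Lemma tensor_ngraded : ngraded gT.
Proof.
split; first exact: tensor_ds.
- move=> m n a b /tensor_gradingP[l [hl ->]] /tensor_gradingP[l' [hl' ->]].
  rewrite big_distrlr /= big_seq; apply: (ds_sum tensor_ds) => z /hl[i [j [<- hi hj]]].
  rewrite big_seq; apply: (ds_sum tensor_ds) => w /hl'[i' [j' [<- hi' hj']]].
  rewrite mulrACA -!rmorphM addnACA; apply: tensor_gr_mul; exact: ngM.
- move=> a; split=> [/tensor_gradingP[l [hl ->]]|[c ->]].
    rewrite big_seq; apply: (big_ind (fun a => exists c : F, a = c%:A)).
    - by exists 0; rewrite scale0r.
    - by move=> _ _ [c ->] [c' ->]; exists (c + c'); rewrite scalerDl.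
    move=> z /hl[i [j [/eqP]]]; rewrite addn_eq0 => /andP[/eqP-> /eqP->].
    move=> /(ng0P hR)[c ->] /(ng0P hS)[c' ->]; exists (c * c').
    by rewrite !linearZ /= !rmorph1 -scalerAl mul1r scalerA.
  have -> : c%:A = iR c%:A * iS 1 :> T by rewrite linearZ /= !rmorph1 mulr1.
  rewrite -[0%N]addn0; apply: tensor_gr_mul; last exact: ng1.
  by apply: (ngraded_scale hR); apply: ng1.
have [K [g [m [_ _ hg _]]]] := hgens_ex hR.
have [K' [g' [m' [_ _ hg' _]]]] := hgens_ex hS.
exists ([seq iR (g k) | k <- enum 'I_K] ++ [seq iS (g' k) | k <- enum 'I_K']).
move=> P PP gP t; have [P1 PL PM] := PP.
have [l ->] := tensor_span hT t.
under eq_bigr do rewrite -[_ %t _]scale1r.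
apply: (subalg_sum PP) => z _; apply: PM.
  have [c ->] := hg z.1; rewrite linear_sum.
  under eq_bigr do rewrite linearZ.
  apply: (subalg_sum PP) => w _; rewrite /mon rmorph_prod.
  under eq_bigr do rewrite rmorphXn.
  apply: (mon_subalg (g := fun k => iR (g k)) PP) => k; apply: gP.
  rewrite mem_cat; apply/orP; left; apply/mapP; exists k => //.
  by rewrite mem_enum.
have [c ->] := hg' z.2; rewrite linear_sum.
under eq_bigr do rewrite linearZ.
apply: (subalg_sum PP) => w _; rewrite /mon rmorph_prod.
under eq_bigr do rewrite rmorphXn.
apply: (mon_subalg (g := fun k => iS (g' k)) PP) => k; apply: gP.
rewrite mem_cat; apply/orP; right; apply/mapP; exists k => //.
by rewrite mem_enum.
Qed.

(** * The Frobenius map and the roots of the tensor product *)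

Section FrobeniusTensor.
Variables (p : nat) (chF : p \in [pchar F]).
Hypothesis perfF : bijective (pFrobenius_aut chF).

Lemma sum_expq (A : comAlgType F) e (I : Type) (r : seq I) (f : I -> A) :
  (\sum_(i <- r) f i) ^+ (p ^ e) = \sum_(i <- r) f i ^+ (p ^ e).
Proof.
apply: (big_morph (fun a => a ^+ (p ^ e)) (exprD_pchar chF e)).
by rewrite expr0n gtn_eqF ?(expq_gt0 chF).
Qed.

Lemma expq_inj (A : comAlgType F) e : reduced A ->
  injective (fun a : A => a ^+ (p ^ e)).
Proof.
move=> redA a b /= ab; apply/eqP; rewrite -subr_eq0; apply/eqP.
apply: (redA _ (p ^ e)%N); apply: (addIr (b ^+ (p ^ e))).
by rewrite -(exprD_pchar chF) subrK ab add0r.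
Qed.

(** The e'-th iterate of Frobenius after the inverse of the e-th. For the original action of F on A,
    a linear map from A^{1/p^e} to A^{1/p^{e'}} is semilinear with respect to it. *)
Lemma root_morph e e' : exists sg : {rmorphism F -> F},
  forall c, sg (c ^+ (p ^ e)) = c ^+ (p ^ e').
Proof.
have [r hr] := dependent_choice (perfect_root perfF e).
have redF : reduced (F^o : comAlgType F).
  by move=> a n /eqP; rewrite expf_eq0 => /andP[_ /eqP].
have rI : injective (fun c : F => c ^+ (p ^ e)) := expq_inj (e := e) redF.
have FD n (a b : F) : (a + b) ^+ (p ^ n) = a ^+ (p ^ n) + b ^+ (p ^ n).
  exact: (exprD_pchar chF (A := F^o)).
have rK c : r (c ^+ (p ^ e)) = c by apply: rI; rewrite -hr.
have rD a b : r (a + b) = r a + r b by apply: rI; rewrite FD -!hr.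
have rM a b : r (a * b) = r a * r b by apply: rI; rewrite exprMn -!hr.
pose f c := r c ^+ (p ^ e').
have fB : zmod_morphism f.
  move=> a b; apply: (addIr (f b)); rewrite -FD -rD !subrK //.
have fM : monoid_morphism f.
  split; first by rewrite /f -(expr1n _ (p ^ e)) rK !expr1n.
  by move=> a b; rewrite /f rM exprMn.
pose L1 := GRing.isZmodMorphism.Build F F f fB.
pose L2 := GRing.isMonoidMorphism.Build F F f fM.
pose g : {rmorphism F -> F} := HB.pack f L1 L2.
by exists g => c; rewrite /= /f rK.
Qed.

(** The Frobenius map of [T] gets an additive left inverse. As F is perfect, the p-th powers form an
    F-subspace of R; a linear projection onto it, followed by p-th roots, is a left inverse of
    Frobenius on R, and likewise on S. Both are semilinear for the inverse Frobenius [sg] of F, so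
    they can be tensored. *)
Lemma tensor_reduced : reduced R -> reduced S -> reduced T.
Proof.
move=> redR redS; have [sg hsg] := root_morph 1 0.
have rho (A : comAlgType F) : reduced A -> exists f : A -> A,
    (forall c x y, f (c *: x + y) = sg c *: f x + f y) /\
    forall x, f (x ^+ (p ^ 1)) = x.
  move=> redA; pose W : {pred A} := fun x => `[< exists y, x = y ^+ (p ^ 1) >].
  have WP : submod_closed W.
    split; first by apply/asboolP; exists 0; rewrite expr0n gtn_eqF ?(expq_gt0 chF).
    move=> c _ _ /asboolP[y ->] /asboolP[z ->]; apply/asboolP.
    have [b ->] := perfect_root perfF 1 c.
    by exists (b *: y + z); rewrite (exprD_pchar chF) exprZn.
  have [f [fW fid]] := complement_proj WP.
  have hg x : exists y, f x = y ^+ (p ^ 1) by apply/asboolP/fW.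
  have [g gP] := dependent_choice hg.
  have gI := expq_inj (e := 1) redA; exists g; split=> [c x y|x]; apply: gI => /=.
    rewrite -gP (exprD_pchar chF) exprZn linearP -!gP.
    by have [b ->] := perfect_root perfF 1 c; rewrite hsg expr1.
  by rewrite -gP fid //; apply/asboolP; exists x.
have [f [fL fK]] := rho R redR; have [g [gL gK]] := rho S redS.
have [H HE] := tensor_semilinear hT fL gL.
have HK t : H (t ^+ (p ^ 1)) = t.
  have [l ->] := tensor_span hT t; rewrite sum_expq raddf_sum.
  by apply: eq_bigr => z _; rewrite exprMn -(rmorphXn iR) -(rmorphXn iS) HE fK gK.
have p0 (t : T) : t ^+ (p ^ 1) = 0 -> t = 0 by move=> t0; rewrite -(HK t) t0 raddf0.
have pn n (t : T) : t ^+ (p ^ n) = 0 -> t = 0.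
  elim: n t => [|n IHn] t; first by rewrite expr1.
  by rewrite expnSr exprM => /p0/IHn.
(* Since n <= p^n, t^n = 0 forces t^{p^n} = 0. *)
move=> t n tn; apply: (pn n); rewrite -(@subnK n (p ^ n)) ?exprD ?tn ?mulr0 //.
by apply/ltnW/ltn_expl/prime_gt1/(pcharf_prime chF).
Qed.

Local Notation frR e := (frob_root_grading chF e gR).
Local Notation frS e := (frob_root_grading chF e gS).
Local Notation frT e := (frob_root_grading chF e gT).

(* Since F is perfect, f and g are semilinear over F with respect to one and
   the same endomorphism of F. *)
Lemma frob_tensor_map e e'
    (f : {linear frob_root R chF e -> frob_root R chF e'})
    (g : {linear frob_root S chF e -> frob_root S chF e'}) :
  exists H : {linear frob_root T chF e -> frob_root T chF e'},
    forall r s, H (r %t s) = (iR (f r) * iS (g s) : T).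
Proof.
have [sg hsg] := root_morph e e'.
have sl (A : comAlgType F)
    (h : {linear frob_root A chF e -> frob_root A chF e'}) c (x y : A) :
    h (c *: x + y : A) = (sg c *: (h x : A) + h y : A).
  have [b ->] := perfect_root perfF e c.
  have -> : b ^+ (p ^ e) *: x + y = b%:A *: (x : frob_root A chF e) + y :> A.
    by rewrite frob_scaleE exprZn expr1n -scalerAl mul1r.
  by rewrite linearP frob_scaleE exprZn expr1n -scalerAl mul1r hsg.
have [H hH] := tensor_semilinear hT (sl R f) (sl S g).
have HL : linear (H : frob_root T chF e -> frob_root T chF e').
  move=> a x y; have -> : H (a *: x + y) = H (a *: x) + H y by apply: raddfD.
  congr (_ + _); rewrite !frob_scaleE.
  (* Compatibility with scalars from [T] reduces to pure tensors, because q-th powers distribute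
     over sums; there it is the linearity of [f] over R and of [g] over S. *)
  have [l ->] := tensor_span hT a; have [m ->] := tensor_span hT (x : T).
  rewrite !sum_expq big_distrlr !raddf_sum big_distrlr; apply: eq_bigr => z _.
  rewrite raddf_sum; apply: eq_bigr => w _ /=.
  rewrite exprMn mulrACA -(rmorphXn iR) -(rmorphXn iS).
  rewrite -(rmorphM iR) -(rmorphM iS).
  rewrite !hH exprMn mulrACA -(rmorphXn iR) -(rmorphXn iS).
  rewrite -(rmorphM iR) -(rmorphM iS).
  have ef : f (z.1 ^+ (p ^ e) * w.1) = z.1 *: f w.1 by rewrite -linearZ.
  have eg : g (z.2 ^+ (p ^ e) * w.2) = z.2 *: g w.2 by rewrite -linearZ.
  by rewrite ef eg.
by have [H' eH] := linear_ex HL; exists H' => r s; rewrite eH hH.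
Qed.

(** The first alternative covers f r = 0 and g s = 0: the element 0 is homogeneous of every rational
    degree, also outside the multiples of 1/p^{e'}. *)
Lemma frob_tensor_homog e e' a b i j r s
    (f : {linear frob_root R chF e -> frob_root R chF e'})
    (g : {linear frob_root S chF e -> frob_root S chF e'}) :
  shifts (frR e) (frR e') a f -> shifts (frS e) (frS e') b g ->
  gR i r -> gS j s ->
  iR (f r) * iS (g s) = 0 :> T \/
  exists i' j', [/\ gR i' (f r), gS j' (g s),
    a + i%:R / (p ^ e)%:R = i'%:R / (p ^ e')%:R &
    b + j%:R / (p ^ e)%:R = j'%:R / (p ^ e')%:R].
Proof.
move=> sf sg hr hs.
have [f0|[i' ei hi]] := sf _ _ (frob_homog chF e hr).
  by left; rewrite f0 linear0 mul0r.
have [g0|[j' ej hj]] := sg _ _ (frob_homog chF e hs).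
  by left; rewrite g0 linear0 mulr0.
by right; exists i', j'.
Qed.

Lemma frob_tensor_shifts e e' a b
    (f : {linear frob_root R chF e -> frob_root R chF e'})
    (g : {linear frob_root S chF e -> frob_root S chF e'})
    (H : {linear frob_root T chF e -> frob_root T chF e'}) :
  shifts (frR e) (frR e') a f -> shifts (frS e) (frS e') b g ->
  (forall r s, H (r %t s) = (iR (f r) * iS (g s) : T)) ->
  shifts (frT e) (frT e') (a + b) H.
Proof.
move=> sf sg HE d x [->|[n -> /tensor_gradingP[l [hl ->]]]].
  by left; rewrite linear0.
have qT := frob_qgraded chF tensor_ngraded e'.
rewrite (linear_sum H) big_seq; apply: (ds_sum (proj1 qT)) => z.
move=> /hl[i [j [<- hi hj]]]; rewrite HE natrD mulrDl addrACA.
have [->|[i' [j' [hi' hj' -> ->]]]] := frob_tensor_homog sf sg hi hj.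
  by left.
by right; exists (i' + j')%N; rewrite ?natrD ?mulrDl //; apply: tensor_gr_mul.
Qed.

End FrobeniusTensor.

End TensorAlgebra.

(** * Factorizations *)

(** The bound applies in both orders, so [C] lies within distance [B] of any of its elements, and in
    one coset of the integers. *)
Lemma bounded_coset (C : set rat) (B : nat) :
  (forall c c', C c -> C c' -> (exists z : int, c' - c = z%:~R) /\ c' <= c + B%:R) ->
  exists cs : seq rat, forall c, C c -> c \in cs.
Proof.
move=> h; have [[c0 h0]|nC] := pselect (exists c, C c); last first.
  by exists [::] => c hc; case: nC; exists c.
exists [seq c0 - B%:R + k%:R | k <- iota 0 (B + B).+1] => c hc.
have [[z ez] le1] := h _ _ h0 hc; have [_ le2] := h _ _ hc h0.
have z1 : z <= B%:Z by rewrite -(ler_int rat) -ez lerBlDl.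
have z2 : 0 <= z + B%:Z.
  by rewrite -(ler_int rat) rmorphD /= -ez addrAC subr_ge0.
have ezB : (absz (z + B%:Z))%:Z = z + B%:Z by rewrite gez0_abs.
apply/mapP; exists (absz (z + B%:Z)).
  by rewrite mem_iota leq0n add0n ltnS /= -lez_nat ezB PoszD lerD2r.
rewrite (pmulrn 1 (absz _)) ezB rmorphD /= -ez -pmulrn; lra.
Qed.

Section Pairs.
Variables (F : fieldType) (p : nat) (chF : p \in [pchar F]).
Hypothesis perfF : bijective (pFrobenius_aut chF).
Variables (R S : comAlgType F) (gR : nat -> set R) (gS : nat -> set S).
Hypotheses (hR : ngraded gR) (hS : ngraded gS).
Local Notation rtR e := (frob_root R chF e).
Local Notation rtS e := (frob_root S chF e).
Local Notation frR e := (frob_root_grading chF e gR).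
Local Notation frS e := (frob_root_grading chF e gS).

(* When the shifts a and b differ, f (x) g does not preserve the diagonal; it
   is then required to vanish there. *)
Definition diag_factors (es : seq nat) (e : nat) (I J : finType)
    (h : I -> R -> R) (h' : J -> S -> S) (i : I) (j : J) :=
  exists (e0 : nat) (a b : rat)
    (f : {linear rtR e -> rtR e0}) (f' : {linear rtR e0 -> rtR e})
    (g : {linear rtS e -> rtS e0}) (g' : {linear rtS e0 -> rtS e}),
  [/\ e0 \in es,
      shifts (frR e) (frR e0) a f /\ shifts (frR e0) (frR e) (- a) f',
      shifts (frS e) (frS e0) b g /\ shifts (frS e0) (frS e) (- b) g',
      (forall x, f' (f x) = h i x) /\ (forall y, g' (g y) = h' j y)
    & a = b \/ forall n r s, gR n r -> gS n s -> f r = 0 \/ g s = 0].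

(** A key records the pair of modules and, if the term meets the diagonal, the difference c of the
    shifts. There are finitely many keys to consider, and [pk] assigns to each an exponent that
    realizes it, if there is one. For a term at [e] the key is realized by [e] itself, hence also by
    [pk key], through which the term is rerouted. *)
Lemma diag_factors_ex : FFRT chF gR -> FFRT chF gS ->
  exists es, forall e, exists (I J : finType) (h : I -> R -> R) (h' : J -> S -> S),
    [/\ forall x, \sum_i h i x = x, forall y, \sum_j h' j y = y
      & forall i j, @diag_factors es e I J h h' i j].
Proof.
move=> /(FFRT_elim hR perfF)[k [L [gL hL]]] /(FFRT_elim hS perfF)[l [N [gN hN]]].
have [D hD] := occurs_bound chF hR; have [D' hD'] := occurs_bound chF hS.
pose occR i e a := occurs chF gR (gL i) e a.
pose occS j e b := occurs chF gS (gN j) e b.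
pose good i j := [/\ integral_support (gL i), exists x : L i, x != 0,
  integral_support (gN j) & exists y : N j, y != 0].
(* The diagonal part of the product of [L i] and [N j], shifted by a and b, is not zero. *)
pose diag i j a b := exists d x y,
  [/\ gL i (a + d) x, gN j (b + d) y, x != 0 & y != 0].
pose C i j : set rat := fun c => exists e a b,
  [/\ occR i e a, occS j e b, good i j, diag i j a b & c = b - a].
have finC (z : 'I_k * 'I_l) : exists cs : seq rat, forall c, C z.1 z.2 c -> c \in cs.
  apply: (@bounded_coset _ (D + D')%N).
  move=> c1 c2 [e [a [b [oa ob [iL nL iN nN] [d [x [y [hx hy x0 y0]]]] ->]]]].
  move=> [e' [a' [b' [oa' ob' _ [d' [x' [y' [hx' hy' x0' y0']]]] ->]]]]; split.
    (* By integral support, (a' + d') - (a + d) and (b' + d') - (b + d) are integers; d and d'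
       cancel in their difference, which is the difference of the two values of c. *)
    have [z1 e1] := iL _ _ _ _ hx hx' x0 x0'.
    have [z2 e2] := iN _ _ _ _ hy hy' y0 y0'.
    exists (z2 - z1); rewrite rmorphB /= -e1 -e2; lra.
  (* Here a <= a' + D and b' <= b + D', so that (b' - a') - (b - a) <= D + D'. *)
  have := hD _ _ _ _ _ _ nL oa' oa; have := hD' _ _ _ _ _ _ nN ob ob'.
  by rewrite natrD; lra.
have [cs hcs] := dependent_choice finC.
pose Q (key : ('I_k * 'I_l) * option rat) e := exists a b,
  [/\ occR key.1.1 e a, occS key.1.2 e b & forall c, key.2 = Some c -> b - a = c].
have pick key : exists e, (exists e', Q key e') -> Q key e.
  have [[e he]|h] := pselect (exists e, Q key e); first by exists e.
  by exists 0%N.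
have [pk hpk] := dependent_choice pick.
pose keys := flatten [seq (z, None) :: [seq (z, Some c) | c <- cs z]
  | z <- enum {: 'I_k * 'I_l}].
exists (map pk keys) => e.
have [I [t [a [al [be [sal sbe abK gdL sumL]]]]]] := hL e.
have [J [u [b [al' [be' [sal' sbe' abK' gdN sumN]]]]]] := hN e.
exists I, J, (fun i x => be i (al i x)), (fun j y => be' j (al' j y)).
split=> // i j.
have oi : occR (t i) e (a i) by exists (al i), (be i).
have oj : occS (u j) e (b j) by exists (al' j), (be' j).
have gd : good (t i) (u j).
  by have [? ?] := gdL i; have [? ?] := gdN j; split.
pose key : ('I_k * 'I_l) * option rat := ((t i, u j),
  if `[< diag (t i) (u j) (a i) (b j) >] then Some (b j - a i) else None).
have [a0 [b0 [oa0 ob0 hc0]]] : Q key (pk key).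
  apply: hpk; exists e, (a i), (b j); split=> // c /=.
  by case: ifP => // _ [].
have hkey : key \in keys.
  apply/flattenP; exists ((key.1, None) :: [seq (key.1, Some c) | c <- cs key.1]).
    by apply/mapP; exists key.1 => //; rewrite mem_enum.
  rewrite /key /=; case: asboolP => [dg|_]; last by rewrite inE eqxx.
  rewrite inE; apply/orP; right; apply/map_f/hcs.
  by exists e, (a i), (b j).
case: oa0 => al0 [be0 [sal0 sbe0 K0]]; case: ob0 => al0' [be0' [sal0' sbe0' K0']].
(* Each map passes through [L (t i)] or [N (u j)], where [K0] and [K0'] cancel the detour to the
   exponent [pk key]. If the key contains c, then b0 - a0 = b j - a i, which makes the two shifts
   equal. *)
exists (pk key), (a i - a0), (b j - b0), (be0 \o al i), (be i \o al0),
  (be0' \o al' j), (be' j \o al0').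
split; first exact: map_f.
- split=> d x hx; rewrite ?opprB.
    by have := sbe0 _ _ (sal i _ _ hx); rewrite addrA [- a0 + _]addrC.
  by have := sbe i _ _ (sal0 _ _ hx); rewrite addrA [- a i + _]addrC.
- split=> d x hx; rewrite ?opprB.
    by have := sbe0' _ _ (sal' j _ _ hx); rewrite addrA [- b0 + _]addrC.
  by have := sbe' j _ _ (sal0' _ _ hx); rewrite addrA [- b j + _]addrC.
- by split=> x /=; rewrite ?K0 ?K0'.
have [dg|ndg] := pselect (diag (t i) (u j) (a i) (b j)).
  left; have := hc0 (b j - a i); rewrite /key /= asboolT // => /(_ erefl); lra.
right=> n r s hr hs; apply: contrapT => nz; apply: ndg.
exists (n%:R / (p ^ e)%:R), (al i r), (al' j s); split.
- exact/sal/frob_homog.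
- exact/sal'/frob_homog.
- by apply/eqP => r0; apply: nz; left; rewrite /= r0 linear0.
- by apply/eqP => s0; apply: nz; right; rewrite /= s0 linear0.
Qed.

End Pairs.

(** * The two products *)

Section Products.
Variables (F : fieldType) (p : nat) (chF : p \in [pchar F]).
Hypothesis perfF : bijective (pFrobenius_aut chF).
Variables (R S T : comAlgType F).
Variables (iR : {lrmorphism R -> T}) (iS : {lrmorphism S -> T}).
Hypothesis hT : is_tensor iR iS.
Variables (gR : nat -> set R) (gS : nat -> set S).
Hypotheses (hR : ngraded gR) (hS : ngraded gS).
Hypotheses (redR : reduced R) (redS : reduced S).
Local Notation "r %t s" := (iR r * iS s) (at level 40).
Local Notation gT := (tensor_grading iR iS gR gS).
Local Notation Sg := (segre iR iS hR hS).
Local Notation gSg := (segre_grading iR iS hR hS).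

Lemma tensor_id_sum e (I J : finType) (h : I -> R -> R) (h' : J -> S -> S)
    (G : I * J -> {linear frob_root T chF e -> frob_root T chF e}) :
  (forall x, \sum_i h i x = x) -> (forall y, \sum_j h' j y = y) ->
  (forall z r s, G z (r %t s) = (h z.1 r %t h' z.2 s : T)) ->
  forall t, \sum_z G z t = t.
Proof.
move=> hs hs' hG t; have [l ->] := tensor_span hT t.
under eq_bigr => z _ do rewrite (linear_sum (G z)).
rewrite exchange_big; apply: eq_bigr => -[r s] _ /=.
under eq_bigr => z _ do rewrite hG.
rewrite -(pair_bigA _ (fun i j => h i r %t h' j s)) /=.
by rewrite -{2}(hs r) -{2}(hs' s) !linear_sum big_distrlr.
Qed.

Lemma FFRT_tensor : FFRT chF gR -> FFRT chF gS -> FFRT chF gT.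
Proof.
move=> fR fS; apply: FFRT_intro => //; first exact: tensor_ngraded.
  exact: (tensor_reduced hT perfF).
have [es hes] := diag_factors_ex perfF hR hS fR fS; exists es => e.
have [I [J [h [h' [hs hs' hd]]]]] := hes e.
have hz (z : I * J) : exists (e0 : nat) (a : rat)
    (al : {linear frob_root T chF e -> frob_root T chF e0})
    (be : {linear frob_root T chF e0 -> frob_root T chF e}),
    [/\ e0 \in es,
       shifts (frob_root_grading chF e gT) (frob_root_grading chF e0 gT) a al,
       shifts (frob_root_grading chF e0 gT) (frob_root_grading chF e gT) (- a) be
     & forall r s, be (al (r %t s)) = (h z.1 r %t h' z.2 s : T)].
  have [e0 [a [b [f [f' [g [g' [he [sf sf'] [sg sg'] [ff gg] _]]]]]]]] := hd z.1 z.2.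
  have [H HE] := frob_tensor_map hT perfF f g.
  have [H' HE'] := frob_tensor_map hT perfF f' g'.
  exists e0, (a + b), H, H'; split=> //.
  - exact: (frob_tensor_shifts hT hR hS sf sg HE).
  - by rewrite opprD; apply: (frob_tensor_shifts hT hR hS sf' sg' HE').
  - by move=> r s; rewrite HE HE' ff gg.
have [e0 he0] := dependent_choice hz; have [a ha] := dependent_choice he0.
have [al hal] := dependent_choice ha; have [be hbe] := dependent_choice hal.
exists (I * J)%type, e0, a, al, be; split=> [z|z|z|]; try by case: (hbe z).
apply: (tensor_id_sum (G := fun z => be z \o al z) hs hs') => z r s /=.
by case: (hbe z) => _ _ _.
Qed.

(** Total, with value 0 off the Segre product, so that lists of its elements can be written without
    membership proofs. *)
Definition to_segre (t : T) : Sg :=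
  if pselect (in_segre iR iS gR gS t) is left h then exist _ t h else 0.

Lemma val_to_segre t : in_segre iR iS gR gS t -> val (to_segre t) = t.
Proof. by rewrite /to_segre; case: pselect. Qed.

Lemma segre_hom n r s : gR n r -> gS n s -> in_segre iR iS gR gS (r %t s).
Proof. by move=> hr hs; apply/asboolP/tensor_sums1; exists n. Qed.

Lemma segreP (t : Sg) : exists l : seq (R * S),
  (forall z, z \in l -> exists n, gR n z.1 /\ gS n z.2) /\
  val t = \sum_(z <- l) z.1 %t z.2.
Proof. by have /asboolP/tensor_sumsP := valP t. Qed.

Lemma segre_gradingP n (t : Sg) : gSg n t <-> exists l : seq (R * S),
  (forall z, z \in l -> gR n z.1 /\ gS n z.2) /\
  val t = \sum_(z <- l) z.1 %t z.2.
Proof. exact: tensor_sumsP. Qed.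

(** Doubling is injective, so this lets the components of the Segre product inherit their
    independence from those of [T]. *)
Lemma segre_gr_tensor n (t : Sg) : gSg n t -> gT (n + n)%N (val t).
Proof.
move=> /segre_gradingP[l [hl ->]]; apply/tensor_gradingP; exists l; split=> //.
by move=> z /hl[h1 h2]; exists n, n.
Qed.

Lemma segre_ds : direct_sum gSg.
Proof.
have zG i : zmod_closed (mem (gSg i)).
  split=> [|x y]; rewrite !in_setE.
    by apply/segre_gradingP; exists [::]; rewrite big_nil.
  move=> hx hy; rewrite /segre_grading /=.
  apply: (@tensor_sums_sub _ _ _ _ iR iS _ (val x) (val y)) => // r s [h1 h2].
  by split=> //; rewrite -scaleN1r; apply: (ngraded_scale hR).
have dT := tensor_ds hT hR hS.
split=> // [t|s f us hf e].
  have [l [hl el]] := segreP t.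
  have [n hn] : exists n : R * S -> nat, forall z,
      (exists n, gR n z.1 /\ gS n z.2) -> gR (n z) z.1 /\ gS (n z) z.2.
    apply: (@dependent_choice _ _ (fun (z : R * S) n =>
      (exists n, gR n z.1 /\ gS n z.2) -> gR n z.1 /\ gS n z.2)) => z.
    have [[m hm]|h] := pselect (exists n, gR n z.1 /\ gS n z.2); first by exists m.
    by exists 0%N.
  have hv z : z \in l -> val (to_segre (z.1 %t z.2)) = z.1 %t z.2.
    by move=> /hl/hn[h1 h2]; apply: val_to_segre; apply: segre_hom h1 h2.
  have [|s [f [us hf ef]]] := @collect_homog _ _ _ gSg l n
    (fun z => to_segre (z.1 %t z.2)) zG.
    move=> z zl; apply/segre_gradingP; exists [:: z]; rewrite big_seq1 hv //.
    by split=> // w; rewrite inE => /eqP ->; apply/hn/hl.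
  exists s, f; split=> //; rewrite -ef; apply: val_inj.
  by rewrite raddf_sum el; apply: eq_big_seq => z zl; apply/esym/hv.
move=> i si; apply: val_inj; rewrite raddf0.
have e0 : \sum_(j <- s) val (f j) = 0 by rewrite -raddf_sum e raddf0.
have := congr1 (dproj gT (i + i)%N) e0.
rewrite dproj0 // (dproj_sum dT).
rewrite (big_rem i) //= (dproj_hom dT _ (segre_gr_tensor (hf i))) eqxx.
rewrite big1_seq ?addr0 // => j /andP[_].
rewrite (mem_rem_uniq _ us) inE => /andP[ji _].
rewrite (dproj_hom dT _ (segre_gr_tensor (hf j))) !addnn.
by rewrite (inj_eq double_inj) eq_sym (negPf ji).
Qed.

(** Tensors of two monomials of equal degree at most [N] generate. Above [N] some exponent u_k
    exceeds the sum of the m' and some v_j the sum of the m. Then the tensor of (g k)^{m' j} and (g'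
    j)^{m k}, of degree (m' j)(m k) <= N on both sides, splits off, and induction on the degree
    applies to the cofactor. *)
Lemma segre_fg : fg_algebra Sg.
Proof.
have [K [g [m [m0 gm _ hg]]]] := hgens_ex hR.
have [K' [g' [m' [m0' gm' _ hg']]]] := hgens_ex hS.
pose N := ((\sum_k m k) * (\sum_k m' k))%N.
pose mm (u : {ffun 'I_K -> nat}) (v : {ffun 'I_K' -> nat}) : T :=
  mon g u %t mon g' v.
have mmS u v : mdeg m u = mdeg m' v -> in_segre iR iS gR gS (mm u v).
  move=> uv; apply: (@segre_hom (mdeg m u)); first exact: ng_mon.
  by rewrite uv; apply: ng_mon.
have mmD (u u' : {ffun 'I_K -> nat}) (v v' : {ffun 'I_K' -> nat}) :
    mm [ffun k => u k + u' k]%N [ffun k => v k + v' k]%N =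
    mm u v * mm u' v'.
  by rewrite /mm !monD !rmorphM mulrACA.
pose fn K0 (u : {ffun 'I_K0 -> 'I_N.+1}) : {ffun 'I_K0 -> nat} := [ffun k => u k : nat].
exists [seq to_segre (mm (fn K z.1) (fn K' z.2)) |
  z <- enum {: {ffun 'I_K -> 'I_N.+1} * {ffun 'I_K' -> 'I_N.+1}}
  & mdeg m (fn K z.1) == mdeg m' (fn K' z.2)].
move=> P PP gP t; have [P1 PL PM] := PP.
(* The subalgebra [P] is moved into [T], where monomials are multiplied without membership
   proofs. *)
pose W : {pred T} := fun x => `[< exists2 s : Sg, s \in P & val s = x >].
have WP : subalg_closed W.
  split; first by apply/asboolP; exists 1 => //; rewrite rmorph1.
    move=> c _ _ /asboolP[x xP <-] /asboolP[y yP <-]; apply/asboolP.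
    by exists (c *: x + y); rewrite ?linearP //; apply: PL.
  move=> _ _ /asboolP[x xP <-] /asboolP[y yP <-]; apply/asboolP.
  by exists (x * y); rewrite ?rmorphM //; apply: PM.
suff : val t \in W by case/asboolP => s sP /val_inj <-.
have base (u : {ffun 'I_K -> nat}) (v : {ffun 'I_K' -> nat}) : 
    mdeg m u = mdeg m' v -> (mdeg m u <= N)%N -> mm u v \in W.
  move=> uv uN; apply/asboolP; exists (to_segre (mm u v)); last first.
    exact/val_to_segre/mmS.
  pose u' : {ffun 'I_K -> 'I_N.+1} := [ffun k => inord (u k)].
  pose v' : {ffun 'I_K' -> 'I_N.+1} := [ffun k => inord (v k)].
  have eu : fn K u' = u.
    apply/ffunP => k; rewrite !ffunE inordK // ltnS.
    exact: leq_trans (mdeg_le u (m0 k)) uN.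
  have ev : fn K' v' = v.
    apply/ffunP => k; rewrite !ffunE inordK // ltnS.
    by apply: leq_trans (mdeg_le v (m0' k)) _; rewrite -uv.
  rewrite -eu -ev; apply: gP; apply/mapP; exists (u', v') => //.
  by rewrite mem_filter mem_enum /= eu ev uv eqxx.
have all_mm n (u : {ffun 'I_K -> nat}) (v : {ffun 'I_K' -> nat}) :
    mdeg m u = n -> mdeg m' v = n -> mm u v \in W.
  elim/ltn_ind: n u v => n IH u v un vn.
  have [nN|Nn] := leqP n N; first by apply: base; rewrite un.
  have [k hk] : exists k, (\sum_k m' k < u k)%N.
    apply: contrapT => h; move: Nn; rewrite ltnNge -un /N mdeg_bound // => k.
    by rewrite leqNgt; apply/negP => hk; apply: h; exists k.
  have [j hj] : exists j, (\sum_k m k < v j)%N.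
    apply: contrapT => h; move: Nn; rewrite ltnNge -vn /N mulnC mdeg_bound // => j.
    by rewrite leqNgt; apply/negP => hj; apply: h; exists j.
  have lk : (m k <= \sum_k m k)%N by rewrite (bigD1 k) //= leq_addr.
  have lj : (m' j <= \sum_k m' k)%N by rewrite (bigD1 j) //= leq_addr.
  pose u1 : {ffun 'I_K -> nat} := [ffun i => (i == k) * m' j]%N.
  pose v1 : {ffun 'I_K' -> nat} := [ffun i => (i == j) * m k]%N.
  pose u2 : {ffun 'I_K -> nat} := [ffun i => u i - u1 i]%N.
  pose v2 : {ffun 'I_K' -> nat} := [ffun i => v i - v1 i]%N.
  have eu : u = [ffun i => u1 i + u2 i]%N.
    apply/ffunP => i; rewrite !ffunE subnKC //; case: eqP => // ->.
    by rewrite mul1n; apply: leq_trans lj (ltnW hk).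
  have ev : v = [ffun i => v1 i + v2 i]%N.
    apply/ffunP => i; rewrite !ffunE subnKC //; case: eqP => // ->.
    by rewrite mul1n; apply: leq_trans lk (ltnW hj).
  have d1 : mdeg m u1 = (m' j * m k)%N.
    rewrite /mdeg (bigD1 k) //= ffunE eqxx mul1n big1 ?addn0 // => i /negPf ik.
    by rewrite ffunE ik.
  have d2 : mdeg m' v1 = (m' j * m k)%N.
    rewrite /mdeg (bigD1 j) //= ffunE eqxx mul1n big1 ?addn0 1?mulnC // => i /negPf ik.
    by rewrite ffunE ik.
  have [_ _ WM] := WP.
  have d0 : (0 < m' j * m k)%N by rewrite muln_gt0 m0 m0'.
  have du : n = (m' j * m k + mdeg m u2)%N by rewrite -d1 -mdegD -eu un.
  have dv : n = (m' j * m k + mdeg m' v2)%N by rewrite -d2 -mdegD -ev vn.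
  rewrite eu ev mmD; apply: WM.
    by apply: base; rewrite d1 ?d2 // mulnC leq_mul.
  apply: (IH (mdeg m u2)) => //.
    by rewrite [X in (_ < X)%N]du -[X in (X < _)%N]add0n ltn_add2r.
  by apply/eqP; rewrite -(eqn_add2l (m' j * m k)) -du -dv.
have [l [hl ->]] := segreP t.
under eq_bigr do rewrite -[_ %t _]scale1r.
rewrite big_seq; apply: (subalg_sum WP) => z /hl[n [hz1 hz2]].
have [l1 [hl1 ->]] := hg _ _ hz1; have [l2 [hl2 ->]] := hg' _ _ hz2.
rewrite [iR _]linear_sum mulr_suml.
under eq_bigr do rewrite linearZ -scalerAl.
rewrite big_seq; apply: (subalg_sum WP) => w wl.
rewrite [iS _]linear_sum mulr_sumr.
under eq_bigr do rewrite linearZ -scalerAr.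
rewrite big_seq; apply: (subalg_sum WP) => w' wl'.
by apply: (all_mm n); [apply: hl1 | apply: hl2].
Qed.

Lemma segre_ngraded : ngraded gSg.
Proof.
split; first exact: segre_ds.
- move=> n k a b /segre_gradingP[l [hl el]] /segre_gradingP[l' [hl' el']].
  pose pr (z z' : R * S) := (z.1 * z'.1, z.2 * z'.2).
  apply/segre_gradingP; exists [seq pr z z' | z <- l, z' <- l']; split.
    move=> _ /allpairsP[[z z'] /= [/hl[h1 h2] /hl'[h3 h4] ->]].
    by split; apply: ngM.
  rewrite rmorphM /= el el' big_distrlr big_allpairs_dep.
  apply: eq_bigr => z _; apply: eq_bigr => z' _.
  by rewrite /= !rmorphM mulrACA.
- move=> a; split=> [/segre_gr_tensor|[c ->]].
    case/(ng0P (tensor_ngraded hT hR hS)) => c ac; exists c.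
    by apply: val_inj; rewrite ac linearZ; congr (_ *: _).
  apply/segre_gradingP; exists [:: (c%:A, 1)]; split.
    move=> z; rewrite inE => /eqP -> /=; split; last exact: ng1.
    by apply: (ngraded_scale hR); apply: ng1.
  rewrite big_seq1 linearZ [RHS]/= linearZ !rmorph1 mulr1.
  by congr (_ *: _).
exact: segre_fg.
Qed.

Lemma segre_reduced : reduced Sg.
Proof.
move=> a n an; apply: val_inj; rewrite raddf0.
apply: (tensor_reduced hT perfF redR redS (n := n)).
by rewrite -rmorphXn an; apply: raddf0.
Qed.

(** With the same shift on both factors, r and s of equal degree have images of equal degree or H (r
    (x) s) = 0, so [H] preserves the diagonal. *)
Lemma segre_restrict e e' a (f : {linear frob_root R chF e -> frob_root R chF e'})
    (g : {linear frob_root S chF e -> frob_root S chF e'})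
    (H : {linear frob_root T chF e -> frob_root T chF e'}) :
  shifts (frob_root_grading chF e gR) (frob_root_grading chF e' gR) a f ->
  shifts (frob_root_grading chF e gS) (frob_root_grading chF e' gS) a g ->
  (forall r s, H (r %t s) = (iR (f r) * iS (g s) : T)) ->
  exists K : {linear frob_root Sg chF e -> frob_root Sg chF e'},
    shifts (frob_root_grading chF e gSg) (frob_root_grading chF e' gSg) a K /\
    forall t, val (K t : Sg) = H (val (t : Sg)).
Proof.
move=> sf sg HE.
have term n r s : gR n r -> gS n s -> H (r %t s) = 0 \/
    exists n', [/\ gR n' (f r), gS n' (g s)
      & a + n%:R / (p ^ e)%:R = n'%:R / (p ^ e')%:R].
  move=> hr hs; rewrite HE.
  have [->|[i [j [hi hj ei ej]]]] := frob_tensor_homog iR iS sf sg hr hs; first by left.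
  right; exists i; split=> //; have -> // : i = j.
  by apply: (qdeg_inj chF (e := e')); rewrite -ei -ej.
have hH (t : Sg) : in_segre iR iS gR gS (H (val t)).
  have [l [hl ->]] := segreP t; rewrite (linear_sum H) big_seq.
  apply: (big_ind (fun x : T => in_segre iR iS gR gS x)).
  - by have := valP (0 : Sg).
  - move=> x y hx hy; have := valP (Sub x hx + Sub y hy : Sg).
    by [].
  move=> z /hl[n [hr hs]]; have [->|[n' [hr' hs' _]]] := term n _ _ hr hs.
    by have := valP (0 : Sg).
  by rewrite HE; apply: segre_hom hr' hs'.
pose k (t : Sg) : Sg := exist _ (H (val t)) (hH t).
have kL : linear (k : frob_root Sg chF e -> frob_root Sg chF e').
  move=> b x y; apply: val_inj.
  have e1 : val (b *: x + y : Sg) =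
      val b *: (val (x : Sg) : frob_root T chF e) + val (y : Sg).
    by rewrite rmorphD frob_scaleE rmorphM rmorphXn.
  have e2 : val (b *: (k x : frob_root Sg chF e') + k y : Sg) =
      val b *: (H (val (x : Sg)) : frob_root T chF e') + H (val (y : Sg)).
    by rewrite rmorphD frob_scaleE rmorphM rmorphXn.
  exact: etrans (congr1 (H : T -> T) e1) (etrans (linearP H _ _ _) (esym e2)).
have [K eK] := linear_ex kL; exists K; split=> [d t|t]; last by rewrite eK.
move=> [->|[n -> /segre_gradingP[l [hl el]]]]; first by left; rewrite linear0.
(* If a + n/p^e is not a natural multiple of 1/p^{e'}, all terms vanish. *)
have [[n' en]|nn] :=
    pselect (exists n', a + n%:R / (p ^ e)%:R = n'%:R / (p ^ e')%:R :> rat).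
  right; exists n' => //; rewrite eK; apply/tensor_sumsP.
  rewrite /= el (linear_sum H).
  (* Terms with image 0 are recorded as (0, 0), since [term] gives no degree for them. *)
  exists [seq (if H (z.1 %t z.2) == 0 then (0, 0) else (f z.1, g z.2) : R * S)
    | z <- l]; split.
    move=> _ /mapP[z /hl[hr hs] ->].
    case: eqP => [_|nz].
      by split; [apply: ds0 (ng_ds hR) _ | apply: ds0 (ng_ds hS) _].
    have [//|[n'' [hr' hs' en'']]] := term n _ _ hr hs.
    by have -> : n' = n'' by apply: (qdeg_inj chF (e := e')); rewrite -en -en''.
  rewrite big_map; apply: eq_bigr => z _; case: eqP => [->|_]; last exact: HE.
  by rewrite linear0 mul0r.
left; rewrite eK; apply: val_inj; rewrite [RHS]raddf0 /= el (linear_sum H) big_seq.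
apply: big1 => z /hl[hr hs]; have [//|[n' [_ _ en]]] := term n _ _ hr hs.
by case: nn; exists n'.
Qed.

(** The identity of the Segre product is the restriction of the sum of the maps [G z] of [T]. On the
    diagonal each [G z] either factors through a root of the Segre product or is 0. *)
Lemma FFRT_segre : FFRT chF gR -> FFRT chF gS -> FFRT chF gSg.
Proof.
move=> fR fS; apply: (FFRT_intro segre_ngraded perfF segre_reduced).
have [es hes] := diag_factors_ex perfF hR hS fR fS; exists es => e.
have [I [J [h [h' [hs hs' hd]]]]] := hes e.
have hz (z : I * J) : exists G : {linear frob_root T chF e -> frob_root T chF e},
    (forall r s, G (r %t s) = (h z.1 r %t h' z.2 s : T)) /\
    exists (e0 : nat) (a : rat)
    (al : {linear frob_root Sg chF e -> frob_root Sg chF e0})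
    (be : {linear frob_root Sg chF e0 -> frob_root Sg chF e}),
    [/\ e0 \in es,
       shifts (frob_root_grading chF e gSg) (frob_root_grading chF e0 gSg) a al,
       shifts (frob_root_grading chF e0 gSg) (frob_root_grading chF e gSg) (- a) be
     & forall t, val (be (al t) : Sg) = G (val (t : Sg))].
  have [e0 [a [b [f [f' [g [g' [he [sf sf'] [sg sg'] [ff gg] ab]]]]]]]] := hd z.1 z.2.
  have [H HE] := frob_tensor_map hT perfF f g.
  have [H' HE'] := frob_tensor_map hT perfF f' g'.
  exists (H' \o H); split; first by move=> r s /=; rewrite HE HE' ff gg.
  case: ab => [ab|van].
    rewrite -ab in sg sg'.
    have [al [sal Eal]] := segre_restrict sf sg HE.
    have [be [sbe Ebe]] := segre_restrict sf' sg' HE'.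
    by exists e0, a, al, be; split=> // t; rewrite Ebe Eal.
  (* [G z] vanishes on the diagonal here, so zero maps represent it; these are homogeneous of any
     degree, and 0 is taken. *)
  have [al Eal] : exists al : {linear frob_root Sg chF e -> frob_root Sg chF e0},
    al =1 fun=> 0 by exists \0.
  have [be Ebe] : exists be : {linear frob_root Sg chF e0 -> frob_root Sg chF e},
    be =1 fun=> 0 by exists \0.
  exists e0, 0, al, be; split=> //.
  - by move=> d x _; rewrite Eal; left.
  - by move=> d x _; rewrite Ebe; left.
  move=> t; rewrite Ebe [LHS]raddf0; have [l [hl ->]] := segreP t.
  rewrite [RHS](linear_sum (H' \o H)) big_seq big1 // => w /hl[n [hr hs2]] /=.
  rewrite HE; have [->|->] := van n _ _ hr hs2.
    by rewrite linear0 mul0r linear0.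
  by rewrite linear0 mulr0 linear0.
have [G hG] := dependent_choice hz.
have [e0 he0] := dependent_choice (fun z => proj2 (hG z)); have [a ha] := dependent_choice he0.
have [al hal] := dependent_choice ha; have [be hbe] := dependent_choice hal.
exists (I * J)%type, e0, a, al, be; split=> [z|z|z|t]; try by case: (hbe z).
apply: val_inj; rewrite [LHS]raddf_sum.
rewrite -[RHS](tensor_id_sum hs hs' (fun z => proj1 (hG z))).
by apply: eq_bigr => z _; have [_ _ _ E] := hbe z; apply: E.
Qed.

End Products.

Theorem proposition5p2
    (F : fieldType) (p : nat) (chF : p \in [pchar F])
    (perfF : bijective (pFrobenius_aut chF))
    (R S : comAlgType F) (gR : nat -> set R) (gS : nat -> set S)
    (hR : ngraded gR) (hS : ngraded gS) (redR : reduced R) (redS : reduced S)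
    (T : comAlgType F) (iR : {lrmorphism R -> T}) (iS : {lrmorphism S -> T})
    (hT : is_tensor iR iS) :
  FFRT chF gR -> FFRT chF gS ->
  FFRT chF (tensor_grading iR iS gR gS) /\
  FFRT chF (segre_grading iR iS hR hS).
Proof.
by move=> fR fS; split; [apply: FFRT_tensor | apply: FFRT_segre].
Qed.
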